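(* Let $m\ge 2$, let $X\subseteq\{0,1,\dots,m-1\}^{\mathbb{N}}$ be a hereditary shift and let $T$ be an unexpandable Markov-Cayley tree. Then: (1) $h(\mathcal{T}_X)=h(X)$; (2) $h(\mathcal{T}_X)>0$ if and only if $\mathcal{T}_X$ has an independence set $S\subseteq T$ with positive density (i.e. $d(S)$ exists and $d(S)>0$). Furthermore, if $X\subseteq\mathcal{A}^{\mathbb{N}}$ is any $\mathbb{N}$ shift over a finite alphabet $\mathcal{A}$ with $|\mathcal{A}|\ge 2$ such that $h(X)=0$, and $T$ is any unexpandable tree, then $\mathcal{T}_X$ has no independence set with positive density.
   Context: Shifts. $\mathbb{N}=\{1,2,\dots\}$. An $\mathbb{N}$ shift over a finite alphabet $\mathcal{A}$ is a closed set $X\subseteq\mathcal{A}^{\mathbb{N}}$ with $\sigma(X)\subseteq X$, where $\sigma((x_i)_{i\ge1})=(x_{i+1})_{i\ge1}$. Its entropy is $h(X)=\lim_{n\to\infty}\frac{1}{n}\log|B_n(X)|$, where $B_n(X)$ is the set of words of length $n$ appearing in points of $X$. A shift $X\subseteq\{0,\dots,m-1\}^{\mathbb{N}}$ is hereditary if whenever $x\in X$ and $y\in\{0,\dots,m-1\}^{\mathbb{N}}$ satisfies $y_i\le x_i$ for all $i$, then $y\in X$. Trees. A tree $T$ is a countable, locally finite (connected) graph without loops (cycles), with a root $\epsilon$, whose vertices are represented as words over $d$ generators $g_1,\dots,g_d$: $T$ is a set of finite words over $\{g_1,\dots,g_d\}$ containing the empty word $\epsilon$ and closed under taking prefixes,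 with an edge from $g$ to $gg_i$ whenever both are in $T$. For a $0$-$1$ matrix $M\in\{0,1\}^{d\times d}$ (indexed by the generators), the Markov-Cayley tree is $$T^M=\{\epsilon\}\cup\{g_1,\dots,g_d\}\cup\{g_{i_1}\cdots g_{i_n}:n\ge2,\ M(g_{i_j},g_{i_{j+1}})=1\ \forall\,1\le j\le n-1\}.$$ $T_n$ is the set of vertices of $T$ of length $n$ (at distance $n$ from $\epsilon$), and $\Delta_n=\bigcup_{i=0}^nT_i$. The expanding number of $T$ is $\gamma_T=\lim_{n\to\infty}|T_{n+1}|/|T_n|\ge1$, whenever this limit exists. $T$ is unexpandable if $\gamma_T$ exists and $\gamma_T=1$. Tree-shift associated with $X$. For an $\mathbb{N}$ shift $X\subseteq\mathcal{A}^{\mathbb{N}}$ and a tree $T$, $$\mathcal{T}_X=\{x\in\mathcal{A}^T:(x_{g_{i_1}g_{i_2}\cdots g_{i_j}})_{j\in\mathbb{N}\cup\{0\}}\in X\text{ for every infinite ray }(g_{i_1}\cdots g_{i_j})_{j\in\mathbb{N}\cup\{0\}}\subseteq T\},$$ where the $j=0$ term of a ray is $\epsilon$, and sequences indexed by $\mathbb{N}\cup\{0\}$ are identified with sequences indexed by $\mathbb{N}$. Its entropy is $$h(\mathcal{T}_X)=\limsup_{n\to\infty}\frac{\log|\mathcal{P}(\Delta_n,\mathcal{T}_X)|}{|\Delta_n|},\qquad \mathcal{P}(\Delta_n,\mathcal{T}_X)=\{(x_g)_{g\in\Delta_n}:x\in\mathcal{T}_X\}.$$ Independence and density. $S\subseteq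 T$ is an independence set of $\mathcal{T}_X$ if for every $u\in\mathcal{A}^S$ there is $t\in\mathcal{T}_X$ with $t_g=u_g$ for all $g\in S$. The density of $S\subseteq T$ is $d(S)=\lim_{n\to\infty}|S\cap\Delta_n|/|\Delta_n|$ when the limit exists.
   Formalization: In (1) and in the ''furthermore'' the tree is assumed to have no leaves (every vertex has a child); in (2), for m≥3, ''h>0 implies an independence set'' is proved only for labels in {0,1} rather than the whole alphabet; both claims fail as originally stated. *)

(* Defs.v *)
From mathcomp Require Import all_boot all_order all_algebra.
From mathcomp Require Import all_classical all_reals all_analysis.

Set Implicit Arguments.
Unset Strict Implicit.
Unset Printing Implicit Defensive.

Import Order.TTheory GRing.Theory Num.Theory.
Import numFieldNormedType.Exports.

Local Open Scope classical_set_scope.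
Local Open Scope ring_scope.

Section Shifts.
Variable A : finType.

(* One-sided sequences are indexed from 0; the topology is the product of the
   discrete topologies. *)
Notation full_shift := (prod_topology (fun _ : nat => discrete_topology A)).

Definition shift_map (x : nat -> A) : nat -> A := fun i => x i.+1.

Definition is_shift (X : set (nat -> A)) : Prop :=
  closed (X : set full_shift) /\ shift_map @` X `<=` X.

Definition words (X : set (nat -> A)) (n : nat) : {set n.-tuple A} :=
  [set w : n.-tuple A | `[< exists2 x, X x &
                 exists k, forall j : 'I_n, tnth w j = x (k + j)%N >] ]%SET.

(* In [ln], the logarithm of 0 is 0, so the empty shift has entropy 0. *)
Definition shift_entropy (R : realType) (X : set (nat -> A)) : \bar R :=
  limn (fun n => (ln (#|words X n|%:R : R) / n%:R)%:E).

End Shifts.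

Definition hereditary (m : nat) (X : set (nat -> 'I_m)) : Prop :=
  forall x y : nat -> 'I_m, X x -> (forall i, (y i <= x i)%N) -> X y.

Section Trees.
Variable d : nat.

(* The word g_{i_1} ... g_{i_n} is the sequence [:: i_1; ...; i_n]. *)
Definition is_tree (T : set (seq 'I_d)) : Prop :=
  T [::] /\ forall u v, T (u ++ v) -> T u.

(* A tree-shift constrains labels along infinite rays only; vertices on no
   infinite ray would carry free labels, even over a shift of entropy 0. *)
Definition leafless (T : set (seq 'I_d)) : Prop :=
  forall g, T g -> exists i, T (rcons g i).

(* [sorted] holds of the empty word and of all one-letter words. *)
Definition markov_tree (M : 'M[bool]_d) : set (seq 'I_d) :=
  [set g | sorted (fun i j => M i j) g].

Definition level (T : set (seq 'I_d)) (n : nat) : {set n.-tuple 'I_d} :=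
  [set g : n.-tuple 'I_d | `[< T g >] ]%SET.

Definition ball (T : set (seq 'I_d)) (n : nat) : {set n.-bseq 'I_d} :=
  [set g : n.-bseq 'I_d | `[< T g >] ]%SET.

(* If some level is empty then so are all later ones, and the ratios, being
   0 / 0 = 0, do not tend to 1. *)
Definition unexpandable (R : realType) (T : set (seq 'I_d)) : Prop :=
  (#|level T n.+1|%:R / #|level T n|%:R : R) @[n --> \oo] --> (1 : R).

Definition has_density (R : realType) (T S : set (seq 'I_d)) (delta : R) : Prop :=
  (#|(ball S n :&: ball T n)%SET|%:R / #|ball T n|%:R : R) @[n --> \oo] --> delta.

Definition ray (T : set (seq 'I_d)) (r : nat -> 'I_d) : Prop :=
  forall j, T (mkseq r j).

End Trees.

Section TreeShifts.
Variables (A : finType) (d : nat).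

(* A point of A^T is represented by a labelling of all words; the labels of
   the words outside T are unconstrained and never inspected. *)
Definition tree_shift (X : set (nat -> A)) (T : set (seq 'I_d)) :
    set (seq 'I_d -> A) :=
  [set x | forall r, ray T r -> X (fun j => x (mkseq r j))].

Definition patterns (X : set (nat -> A)) (T : set (seq 'I_d)) (n : nat) :
    {set {ffun {g : n.-bseq 'I_d | g \in ball T n} -> A}} :=
  [set p : {ffun {g : n.-bseq 'I_d | g \in ball T n} -> A} | `[< exists2 x, tree_shift X T x &
                 forall g, p g = x (val g) >] ]%SET.

Definition tree_entropy (R : realType) (X : set (nat -> A))
    (T : set (seq 'I_d)) : \bar R :=
  limn_esup (fun n => (ln (#|patterns X T n|%:R : R) / #|ball T n|%:R)%:E).

(* Independence over a set B of symbols: every B-valued labelling of S extends.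
   The independence sets of the tree-shift are those with B the whole
   alphabet, but a hereditary shift of positive entropy need not use all the
   letters: {0,1}^N inside {0,1,2}^N. *)
Definition independent_over (B : set A) (X : set (nat -> A))
    (T S : set (seq 'I_d)) : Prop :=
  forall u : seq 'I_d -> A, (forall g, S g -> B (u g)) ->
    exists2 t, tree_shift X T t & forall g, S g -> t g = u g.

Definition has_dense_independent_set (R : realType) (B : set A)
    (X : set (nat -> A)) (T : set (seq 'I_d)) : Prop :=
  exists S : set (seq 'I_d),
    [/\ S `<=` T, independent_over B X T S &
        exists2 delta : R, 0 < delta & has_density T S delta].

End TreeShifts.

(* Main.v *)
Require Import Defs.
From mathcomp Require Import all_boot all_order all_algebra.
From mathcomp Require Import all_classical all_reals all_analysis.
From mathcomp Require Import zify ring lra.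

(** Let [X] be a shift and [T] an unexpandable tree. Since the ratio of
    consecutive levels tends to 1, a block of [k] consecutive late levels is
    covered, up to a small proportion of its vertices, by disjoint paths of
    length [k] that lie on rays, provided that almost all vertices lie on rays
    (in a leafless tree all of them do). The labels along a path form a word
    of [X], so the patterns over the block are essentially counted by a power
    of the number of words of length [k], and the entropy of the tree-shift is
    at most that of [X] ([traces_tree_block], [tree_entropy_le]). An
    independence set of positive density forces positive entropy
    ([dense_independent_entropy]), hence there is none over a leafless
    unexpandable tree when [X] has entropy 0.

    For a Markov-Cayley tree without leaves and a hereditary shift the
    converse inequality holds. Branching vertices are rare, since each of them
    increases the size of the next level, and a letter from which branching is
    reachable leads to it in a bounded number of steps; so almost all vertices
    lie on disjoint rays without branching ([nonunary_small]). Labelling each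
    of these rays by a point of [X], read from the depth at which the ray
    starts, and all other vertices by 0 gives a point of the tree-shift
    because [X] is hereditary ([entry_labelling]); the rays are labelled
    independently, so the entropy is at least that of [X]
    ([tree_entropy_ge]).

    It remains to build a dense independence set from positive entropy, over a
    Markov-Cayley tree that may have leaves. An exponential growth of the
    levels being excluded, no letter has two closed walks of the same length,
    and then the number of words of length [n] that end in a given letter is
    eventually 0 or of exact order [n ^ k] for some [k] ([walks_to_has_degree]). So two
    letters have comparable numbers of occurrences
    ([dead_letter_or_mostly_live]). Either some letter from which no ray
    starts occupies a fixed proportion of every late level: its occurrences
    carry free labels, and a subset of them has a density ([dense_subset]). Or
    almost all vertices lie on rays, and then [X] itself has positive entropy
    by the upper bound. In that case some point of [X] has nonzero letters with
    a positive frequency ([nonzero_frequency]): the maximal number of nonzero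
    letters in a word is subadditive, its growth rate is positive by a counting
    argument, and compactness yields a point realizing it. The live vertices
    whose depth is in the support of this point form an independence set for
    the letters 0 and 1, because [X] is hereditary. Its density exists by
    summation by parts, the numbers of live vertices on the levels being
    nondecreasing and of polynomial growth ([abel_frequency]). *)

Set Implicit Arguments.
Unset Strict Implicit.
Unset Printing Implicit Defensive.

Import Order.TTheory GRing.Theory Num.Theory.
Import numFieldNormedType.Exports.

Local Open Scope classical_set_scope.
Local Open Scope ring_scope.

(** * Counting the restrictions of a set of labellings *)

Section Traces.
Variables (A : finType).
Local Open Scope nat_scope.

(** The set of restrictions is kept as a duplicate-free list of words, rather
    than as a set of tuples, so that windows of different sizes can be
    compared without casts. *)
Definition trace_words (I : Type) (Y : set (I -> A)) (F : seq I) : seq (seq A) :=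
  [seq tval w | w <- enum [set w : (size F).-tuple A |
     `[< exists2 x, Y x & [seq x g | g <- F] = w >] ]%SET].

Definition traces (I : Type) (Y : set (I -> A)) (F : seq I) : nat :=
  size (trace_words Y F).

Lemma trace_wordsP (I : Type) (Y : set (I -> A)) (F : seq I) (s : seq A) :
  reflect (exists2 x, Y x & [seq x g | g <- F] = s) (s \in trace_words Y F).
Proof.
apply: (iffP mapP) => [[w]|[x Yx <-]].
  by rewrite mem_enum inE => /asboolP[x Yx xw] ->; exists x.
by exists (map_tuple x (in_tuple F)) => //; rewrite mem_enum inE; apply/asboolP; exists x.
Qed.

Lemma trace_words_uniq (I : Type) (Y : set (I -> A)) (F : seq I) :
  uniq (trace_words Y F).
Proof. by rewrite map_inj_uniq ?enum_uniq//; exact: val_inj. Qed.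

Lemma size_trace_word (I : Type) (Y : set (I -> A)) (F : seq I) (s : seq A) :
  s \in trace_words Y F -> size s = size F.
Proof. by move=> /trace_wordsP[x _ <-]; rewrite size_map. Qed.

Lemma traces_gt0 (I : Type) (Y : set (I -> A)) (F : seq I) :
  Y !=set0 -> 0 < traces Y F.
Proof.
move=> [x Yx]; rewrite /traces -has_predT; apply/hasP.
by exists [seq x g | g <- F] => //; apply/trace_wordsP; exists x.
Qed.

(** Restrictions are compared by moving the labellings themselves: it is enough
    that the image under [h] of a labelling, seen on [G], determines the
    original one on [F]. *)
Lemma traces_le_image (I J : Type) (Y : set (I -> A)) (Z : set (J -> A))
    (F : seq I) (G : seq J) (h : (I -> A) -> (J -> A)) :
  (forall x, Y x -> Z (h x)) ->
  (forall x y, Y x -> Y y -> [seq h x g | g <- G] = [seq h y g | g <- G] ->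
    [seq x g | g <- F] = [seq y g | g <- F]) ->
  traces Y F <= traces Z G.
Proof.
move=> YZ inj_h.
pose f s := if pselect (exists2 x, Y x & [seq x g | g <- F] = s) is left e
  then [seq h (s2val (cid2 e)) g | g <- G] else [::].
rewrite /traces -(size_map f); apply: uniq_leq_size.
  rewrite map_inj_in_uniq ?trace_words_uniq// => s t.
  move=> /trace_wordsP es /trace_wordsP et; rewrite /f.
  case: pselect => // e1; case: pselect => // e2.
  by case: cid2 => x /= Yx <-; case: cid2 => y /= Yy <-; exact: inj_h.
move=> _ /mapP[s /trace_wordsP es ->]; rewrite /f; case: pselect => // e.
by case: cid2 => x /= Yx _; apply/trace_wordsP; exists (h x) => //; exact: YZ.
Qed.

Lemma traces_sub (I : eqType) (Y : set (I -> A)) (F G : seq I) :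
  {subset F <= G} -> traces Y F <= traces Y G.
Proof.
move=> FG; apply: (traces_le_image (h := id)) => // x y _ _ /eq_in_map xy.
by apply/eq_in_map => g /FG /xy.
Qed.

Lemma traces_le (I J : Type) (Y : set (I -> A)) (Z : set (J -> A))
    (F : seq I) (G : seq J) :
  (forall x, Y x -> exists2 z, Z z & [seq z g | g <- G] = [seq x g | g <- F]) ->
  traces Y F <= traces Z G.
Proof.
move=> YZ; apply: uniq_leq_size; first exact: trace_words_uniq.
move=> _ /trace_wordsP[x Yx <-]; have [z Zz zx] := YZ _ Yx.
by apply/trace_wordsP; exists z.
Qed.

Lemma traces_cat (I : Type) (Y : set (I -> A)) (F G : seq I) :
  traces Y (F ++ G) <= traces Y F * traces Y G.
Proof.
rewrite /traces -(size_allpairs cat); apply: uniq_leq_size.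
  exact: trace_words_uniq.
move=> _ /trace_wordsP[x Yx <-]; rewrite map_cat; apply/allpairsP.
exists ([seq x g | g <- F], [seq x g | g <- G]).
by split => //; apply/trace_wordsP; exists x.
Qed.

Lemma traces_le_card (I : Type) (Y : set (I -> A)) (F : seq I) :
  traces Y F <= #|A| ^ size F.
Proof. by rewrite /traces size_map -cardE -card_tuple max_card. Qed.

(** If the blocks [F j] can be labelled independently of each other, each by
    any of the windows [G j] of points of [Z j], the counts multiply. *)
Lemma traces_prod_le (I K : Type) (J : eqType) (Y : set (I -> A))
    (Z : J -> set (K -> A)) (F : J -> seq I) (G : J -> seq K) (js : seq J) :
  uniq js -> (forall j, Z j !=set0) ->
  (forall z : J -> K -> A, (forall j, Z j (z j)) ->
    exists2 y, Y y & forall j, j \in js ->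
      [seq y g | g <- F j] = [seq z j g | g <- G j]) ->
  \prod_(j <- js) traces (Z j) (G j) <= traces Y (flatten [seq F j | j <- js]).
Proof.
move=> js_uniq Z0 free.
pose words := foldr (fun j acc =>
  [seq u ++ v | u <- trace_words (Z j) (G j), v <- acc]) [:: [::]].
have -> : \prod_(j <- js) traces (Z j) (G j) = size (words js).
  elim: (js) => [|j l IH] /=; first by rewrite big_nil.
  by rewrite big_cons IH size_allpairs.
apply: uniq_leq_size.
  elim: (js) => //= j l IH; apply: allpairs_uniq => //.
    exact: trace_words_uniq.
  move=> [u v] [u' v'] /allpairsP[[a b] /= [aG _ [-> ->]]].
  move=> /allpairsP[[a' b'] /= [a'G _ [-> ->]]] /eqP.
  by rewrite eqseq_cat ?(size_trace_word aG) ?(size_trace_word a'G)// => /andP[/eqP-> /eqP->].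
have joint w : w \in words js -> exists2 z : J -> K -> A, (forall j, Z j (z j)) &
    w = flatten [seq [seq z j g | g <- G j] | j <- js].
  elim: js js_uniq {free} w => [_|j l IH /= /andP[jl /IH{}IH]] w.
    rewrite inE => /eqP ->; have /choice[z Zz] := Z0; by exists z.
  move=> /allpairsP[[u v] /= [/trace_wordsP[x Zx <-] /IH[z Zz ->] ->]].
  exists (fun j' => if pselect (j' = j) is left _ then x else z j').
    by move=> j'; case: pselect => [->|].
  congr (_ ++ flatten _); first by case: pselect.
  apply/eq_in_map => j' j'l; case: pselect => // jj'.
  by rewrite -jj' j'l in jl.
move=> w /joint[z Zz ->]; have [y Yy yz] := free _ Zz.
apply/trace_wordsP; exists y => //; rewrite map_flatten; congr flatten.
by rewrite -map_comp; apply/eq_in_map => j jjs /=; rewrite yz.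
Qed.

End Traces.

(** * Polynomial growth of the number of walks *)

Section PolynomialGrowth.
Local Open Scope nat_scope.

(** Growth rates are compared with integer constants only, so that the
    estimates below are integer arithmetic. *)
Definition eventually_zero (f : nat -> nat) : Prop :=
  exists n0, forall n, n0 <= n -> f n = 0.

Definition poly_growth (f : nat -> nat) (k : nat) : Prop :=
  exists C n0, forall n, n0 <= n -> n ^ k <= C * f n /\ f n <= C * n ^ k.

Definition has_degree (f : nat -> nat) : Prop :=
  eventually_zero f \/ exists k, poly_growth f k.

Lemma expn_add_ge (n N k : nat) : 0 < N -> n ^ k.+1 + n ^ k <= (n + N) ^ k.+1.
Proof.
move=> N0; rewrite !expnS -mulSnr leq_mul//; first lia.
by case: k => // k; rewrite leq_exp2r// leq_addr.
Qed.

Lemma expn_add_le (N k : nat) :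
  exists D, forall n, 0 < n -> (n + N) ^ k.+1 <= n ^ k.+1 + D * n ^ k.
Proof.
elim: k => [|k [D IH]]; first by exists N => n _; rewrite !expn1 expn0 muln1.
exists (D + N + N * D) => n n0; rewrite expnS.
apply: (leq_trans (leq_mul (leqnn _) (IH n n0))).
have -> : n ^ k.+2 = n * (n * n ^ k) by rewrite !expnS.
rewrite !expnS; move: (n ^ k) => x; nia.
Qed.

Lemma eq_has_degree (f g : nat -> nat) : f =1 g -> has_degree f -> has_degree g.
Proof. by move=> /funext ->. Qed.

Lemma has_degree0 : has_degree (fun=> 0).
Proof. by left; exists 0. Qed.

Lemma has_degreeD (f g : nat -> nat) :
  has_degree f -> has_degree g -> has_degree (fun n => f n + g n).
Proof.
move=> [[n0 f0]|[k [C [n0 fk]]]] [[n1 g0]|[l [D [n1 gl]]]].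
- by left; exists (n0 + n1) => n nn; rewrite f0 ?g0//; lia.
- right; exists l, D, (n0 + n1) => n nn; rewrite f0; last lia.
  by apply: gl; lia.
- right; exists k, C, (n0 + n1) => n nn; rewrite g0 ?addn0; last lia.
  by apply: fk; lia.
- right; exists (maxn k l), (C + D), (n0 + n1).+1 => n nn.
  have [f1 f2] : n ^ k <= C * f n /\ f n <= C * n ^ k by apply: fk; lia.
  have [g1 g2] : n ^ l <= D * g n /\ g n <= D * n ^ l by apply: gl; lia.
  have k_max : n ^ k <= n ^ maxn k l by rewrite leq_pexp2l ?leq_maxl//; lia.
  have l_max : n ^ l <= n ^ maxn k l by rewrite leq_pexp2l ?leq_maxr//; lia.
  split; last by nia.
  by case: (leqP k l) => kl; nia.
Qed.

Lemma has_degreeM (c : nat) (f : nat -> nat) :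
  has_degree f -> has_degree (fun n => c * f n).
Proof.
move=> fd; elim: c => [|c IH]; first exact: eq_has_degree has_degree0.
by apply: eq_has_degree (has_degreeD fd IH) => n; rewrite mulSn.
Qed.

Lemma has_degree_sum (I : Type) (r : seq I) (P : pred I) (f : I -> nat -> nat) :
  (forall i, P i -> has_degree (f i)) ->
  has_degree (fun n => \sum_(i <- r | P i) f i n).
Proof.
move=> fd; elim: r => [|i r IH].
  by apply: eq_has_degree has_degree0 => n; rewrite big_nil.
case: (boolP (P i)) => Pi.
  by apply: eq_has_degree (has_degreeD (fd _ Pi) IH) => n; rewrite big_cons Pi.
by apply: eq_has_degree IH => n; rewrite big_cons (negbTE Pi).
Qed.

Lemma has_degree_shift (N : nat) (f g : nat -> nat) :
  (forall n, f (n + N) = g n) -> has_degree g -> has_degree f.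
Proof.
move=> fg [[n0 g0]|[k [C [n0 gk]]]].
  by left; exists (n0 + N) => n nn; rewrite -[n](@subnK N) ?fg ?g0//; lia.
right; exists k, (C * (N.+1) ^ k), (n0 + N).+1 => n nn.
have -> : f n = g (n - N) by rewrite -fg subnK//; lia.
have [g1 g2] : (n - N) ^ k <= C * g (n - N) /\ g (n - N) <= C * (n - N) ^ k.
  by apply: gk; lia.
split.
  have : n ^ k <= N.+1 ^ k * (n - N) ^ k.
    by rewrite -expnMn; case: (k) => // l; rewrite leq_exp2r//; nia.
  nia.
apply: (leq_trans g2); rewrite -mulnA leq_mul//.
rewrite (@leq_trans (n ^ k))//; last by rewrite leq_pmull// expn_gt0.
by case: (k) => // l; rewrite leq_exp2r//; lia.
Qed.

(** Summing a sequence of degree [k] along an arithmetic progression raises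
    the degree by one; positivity of [f] takes care of the start of the
    progression when nothing is added later. *)
Lemma has_degree_cumul (N : nat) (f g : nat -> nat) :
  0 < N -> (forall n, 0 < f n) -> (forall n, f (n + N) = f n + g n) ->
  has_degree g -> has_degree f.
Proof.
move=> N0 f_gt0 fg; pose S n := \sum_(i < n + N) f i.
have le_S n0 n : n < n0 + N -> f n <= S n0.
  by move=> nn; rewrite /S (bigD1 (Ordinal nn)) //= leq_addr.
have step n0 (P : nat -> Prop) : (forall n, n0 <= n < n0 + N -> P n) ->
    (forall n, n0 <= n -> P n -> P (n + N)) -> forall n, n0 <= n -> P n.
  move=> base ind n; have [m] := ubnP n; elim: m n => // m IH n nm n0n.
  case: (ltnP n (n0 + N)) => nn; first by apply: base; rewrite n0n.
  by rewrite -[n](@subnK N); [apply: ind; [lia|apply: IH; lia]|lia].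
case=> [[n0 g0]|[k [C [n0 gk]]]]; right.
  exists 0, (S n0).+1, n0; apply: step => [n /andP[nn nN]|n nn].
    by rewrite expn0 muln1; have := f_gt0 n; have := le_S _ _ nN; nia.
  by rewrite !expn0 fg g0// addn0.
have [D HD] := expn_add_le N k.
exists k.+1, ((n0.+1 + N) ^ k.+1 + D * C + C + S n0.+1), n0.+1.
apply: step => [n /andP[nn nN]|n nn [lo hi]].
  split.
    have : n ^ k.+1 <= (n0.+1 + N) ^ k.+1 by rewrite leq_exp2r//; lia.
    by have := f_gt0 n; nia.
  have : 0 < n ^ k.+1 by rewrite expn_gt0; lia.
  by have := le_S _ _ nN; nia.
have [g1 g2] : n ^ k <= C * g n /\ g n <= C * n ^ k by apply: gk; lia.
have n0' : 0 < n by lia.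
have := HD _ n0'; have := expn_add_ge n k N0.
move: lo hi g1 g2; rewrite !fg; set a := n ^ k; set b := n ^ k.+1.
set c := (n + N) ^ _; set e := (n0.+1 + N) ^ _; move: (S _) => s lo hi g1 g2 h1 h2.
split; last by nia.
apply: (leq_trans h2); rewrite mulnDr leq_add//.
apply: (@leq_trans (D * (C * g n))); first by rewrite leq_mul.
by rewrite mulnA leq_mul//; nia.
Qed.

End PolynomialGrowth.

Section Walks.
Variables (d : nat) (M : rel 'I_d).
Local Open Scope nat_scope.

Fixpoint walks (n : nat) (j i : 'I_d) : nat :=
  if n is n'.+1 then \sum_k walks n' j k * M k i else (j == i).

Fixpoint walks_to (n : nat) (i : 'I_d) : nat :=
  if n is n'.+1 then \sum_k walks_to n' k * M k i else 1.

Lemma walksD (n m : nat) (j i : 'I_d) :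
  walks (n + m) j i = \sum_k walks n j k * walks m k i.
Proof.
elim: m i => [|m IH] i.
  rewrite addn0 (bigD1 i)//= eqxx muln1 big1 ?addn0// => k /negbTE ki.
  by rewrite ki muln0.
rewrite addnS /=; under eq_bigr do rewrite IH big_distrl/=.
rewrite exchange_big/=; apply: eq_bigr => k _.
by rewrite big_distrr/=; apply: eq_bigr => l _; rewrite mulnA.
Qed.

Lemma walks_toD (n m : nat) (i : 'I_d) :
  walks_to (n + m) i = \sum_k walks_to n k * walks m k i.
Proof.
elim: m i => [|m IH] i.
  rewrite addn0 (bigD1 i)//= eqxx muln1 big1 ?addn0// => k /negbTE ki.
  by rewrite ki muln0.
rewrite addnS /=; under eq_bigr do rewrite IH big_distrl/=.
rewrite exchange_big/=; apply: eq_bigr => k _.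
by rewrite big_distrr/=; apply: eq_bigr => l _; rewrite mulnA.
Qed.

Lemma walksM_le (n m : nat) (j k i : 'I_d) :
  walks n j k * walks m k i <= walks (n + m) j i.
Proof. by rewrite walksD (bigD1 k)//= leq_addr. Qed.

Lemma walks_toM_le (n m : nat) (k i : 'I_d) :
  walks_to n k * walks m k i <= walks_to (n + m) i.
Proof. by rewrite walks_toD (bigD1 k)//= leq_addr. Qed.

Lemma walks_le_walks_to (n : nat) (j i : 'I_d) : walks n j i <= walks_to n i.
Proof.
elim: n i => [|n IH] i /=; first by case: eqP.
by apply: leq_sum => k _; rewrite leq_mul.
Qed.

Lemma walks_closedX (n t : nat) (i : 'I_d) :
  walks n i i ^ t <= walks (n * t) i i.
Proof.
elim: t => [|t IH]; first by rewrite muln0 /= eqxx.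
by rewrite mulnS expnS (leq_trans _ (walksM_le _ _ _ i _))// leq_mul.
Qed.

Lemma walks_to_anti (m n : nat) (i : 'I_d) :
  m <= n -> 0 < walks_to n i -> 0 < walks_to m i.
Proof.
move=> mn; rewrite -(subnK mn) walks_toD lt0n sum_nat_eq0.
case/forallPn => k; rewrite implyTb muln_eq0 negb_or => /andP[_].
by rewrite -lt0n => /leq_trans; apply; exact: walks_le_walks_to.
Qed.

Hypothesis unique_closed : forall i n, walks n i i <= 1.

(** The length of some closed walk through [i], or 1 if there is none, so that
    a common multiple of the periods exists in all cases. *)
Definition period (i : 'I_d) : nat :=
  if pselect (exists n, 0 < n /\ 0 < walks n i i) is left e
  then proj1_sig (cid e) else 1.

Lemma period_gt0 i : 0 < period i.
Proof. by rewrite /period; case: pselect => // e; case: cid => n []. Qed.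

Definition common_period : nat := \prod_i period i.

Lemma common_period_gt0 : 0 < common_period.
Proof. by rewrite prodn_gt0// => i; exact: period_gt0. Qed.

Lemma walks_common_period n i :
  0 < n -> 0 < walks n i i -> 0 < walks common_period i i.
Proof.
move=> n0 wi; rewrite /common_period (bigD1 i)//=.
apply: leq_trans (walks_closedX _ _ _); rewrite expn_gt0.
by rewrite {1}/period; case: pselect => [e|[]]; [case: cid => m [_ ->]|exists n].
Qed.

Definition upstream (i : 'I_d) : {set 'I_d} :=
  [set k | `[< exists n, 0 < walks n k i >] ]%SET.

(** Over a common period, the letters other than [i] that lead to [i] cannot be
    reached back from it: otherwise going around [j] before or after the detour
    through [i] would give two closed walks of the same length. *)
Lemma upstream_proper (i j : 'I_d) :
  j != i -> 0 < walks common_period j i -> upstream j \proper upstream i.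
Proof.
move=> ji wji; apply/properP; split.
  apply/fintype.subsetP => k; rewrite !inE => -[n wkj].
  by exists (n + common_period); apply: leq_trans (walksM_le _ _ _ j _); rewrite muln_gt0 wkj.
exists i; first by rewrite !inE; exists 0; rewrite /= eqxx.
apply/negP; rewrite !inE => -[s wij]; set N := common_period in wji *.
have N0 : 0 < N := common_period_gt0.
have wjj : 0 < walks (N + s) j j.
  by apply: leq_trans (walksM_le _ _ _ i _); rewrite muln_gt0 wji.
have wNj : 0 < walks N j j.
  by apply: walks_common_period wjj; rewrite addn_gt0 N0.
have wij' : 0 < walks (s + N) i j.
  by apply: leq_trans (walksM_le _ _ _ j _); rewrite muln_gt0 wij.
have := unique_closed j (N + (s + N)).
rewrite walksD (bigD1 j)//= (bigD1 i)/=; last by rewrite eq_sym.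
rewrite [s + N]addnC in wij' *.
move: (walks N j j) (walks (N + s) j j) (walks N j i) (walks (N + s) i j)
   wNj wjj wji wij'.
nia.
Qed.

(** Sampled along a common period, the number of walks to [i] satisfies
    [f (n + N) = f n + g n] or [f (n + N) = g n], where [g] collects the walks
    that come from letters strictly upstream of [i]; induction on the set of
    upstream letters concludes. *)
Lemma walks_to_has_degree (i : 'I_d) : has_degree (walks_to ^~ i).
Proof.
have [c] := ubnP #|upstream i|; elim: c i => // c IH i ic.
set N := common_period.
pose g n := \sum_(k | k != i) walks_to n k * walks N k i.
have gd : has_degree g.
  apply: has_degree_sum => k ki.
  have [->|wki] := posnP (walks N k i).
    by apply: eq_has_degree has_degree0 => n; rewrite muln0.
  have := has_degreeM (walks N k i) (IH k _).
  have := proper_card (upstream_proper ki wki) => kc /(_ (leq_trans kc _)).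
  by move=> H; apply: eq_has_degree (H _) => [n|]; [rewrite mulnC|].
have rec n : walks_to (n + N) i = walks_to n i * walks N i i + g n.
  by rewrite walks_toD (bigD1 i).
have := unique_closed i N; rewrite leq_eqVlt ltnS leqn0 => /orP[|] /eqP wi.
  apply: has_degree_cumul gd; first exact: common_period_gt0.
    move=> n; apply: (@walks_to_anti _ (N * n)).
      by rewrite leq_pmull// common_period_gt0.
    apply: leq_trans (walks_le_walks_to _ i _).
    by apply: leq_trans (walks_closedX _ _ _); rewrite wi exp1n.
  by move=> n; rewrite rec wi muln1.
by apply: (has_degree_shift (N := N)) gd => n; rewrite rec wi muln0.
Qed.

End Walks.

(** * Asymptotic estimates *)

Section Asymptotics.
Variable R : realType.
Implicit Types (u s t S B : nat -> R) (l h e C : R).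

Lemma cvgnP u l :
  u @ \oo --> l <->
  forall e, 0 < e -> exists n0, forall n, (n0 <= n)%N -> `|u n - l| <= e.
Proof.
split=> [/cvgrPdistC_le ul e e0|ul].
  by have [n0 _ H] := ul _ e0; exists n0 => n nn; apply: H.
by apply/cvgrPdistC_le => e /ul[n0 H]; exists n0 => // n /= /H.
Qed.

Lemma limn_esup_le_near (u : nat -> \bar R) (M : \bar R) n0 :
  (forall n, (n0 <= n)%N -> (u n <= M)%E) -> (limn_esup u <= M)%E.
Proof.
move=> uM; rewrite limn_esup_lim; apply: lime_le; first exact: is_cvg_esups.
exists n0 => // n /= nn; apply: ge_ereal_sup => _ [k /= nk <-].
by apply: uM; exact: leq_trans nk.
Qed.

Lemma limn_esup_ge_near (u : nat -> \bar R) (M : \bar R) n0 :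
  (forall n, (n0 <= n)%N -> (M <= u n)%E) -> (M <= limn_esup u)%E.
Proof.
move=> uM; rewrite limn_esup_lim; apply: lime_ge; first exact: is_cvg_esups.
exists n0 => // n /= nn; apply: (le_trans (uM n nn)).
by apply: ereal_sup_ubound; exists n => /=.
Qed.

(** Convergence of ratios is handled through estimates up to [e * B n + C],
    which are stable under addition and summation. *)
Lemma linear_error_cvg S B l :
  (forall C, exists n0, forall n, (n0 <= n)%N -> C <= B n) ->
  (forall e, 0 < e -> exists C n0, forall n, (n0 <= n)%N ->
    `|S n - l * B n| <= e * B n + C) ->
  (S n / B n) @[n --> \oo] --> l.
Proof.
move=> By err; apply/cvgnP => e e0.
have e2 : 0 < e / 2 by lra.
have [C [n1 HC]] := err _ e2.
have [n0 Hn0] := By (Num.max 1 (C * 2 / e)).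
exists (n0 + n1)%N => n nn; have := Hn0 n ltac:(lia); rewrite ge_max => /andP[B1 BC].
have B0 : 0 < B n by rewrite (lt_le_trans _ B1).
have -> : S n / B n - l = (S n - l * B n) / B n by field; rewrite gt_eqF.
rewrite normrM normfV (gtr0_norm B0) ler_pdivrMr//.
apply: (le_trans (HC n ltac:(lia))); move: BC; rewrite ler_pdivrMr// => BC.
by lra.
Qed.

(** The Stolz-Cesaro theorem: an error that is relatively small on each late
    term is relatively small on the sums. *)
Lemma weighted_cesaro s t l :
  (forall n, 0 <= t n) ->
  (forall e, 0 < e -> exists n0, forall n, (n0 <= n)%N ->
    `|s n - l * t n| <= e * t n) ->
  forall e, 0 < e -> exists C, forall n,
    `|\sum_(i < n) s i - l * \sum_(i < n) t i| <= e * \sum_(i < n) t i + C.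
Proof.
move=> t0 st e e0; have [n0 H] := st e e0.
exists (\sum_(i < n0) `|s i - l * t i|) => n.
elim: n => [|n IH].
  rewrite !big_ord0 !mulr0 subr0 normr0 add0r.
  by apply: sumr_ge0 => i _.
case: (leqP n0 n) => nn.
  rewrite !big_ord_recr/=; have := H _ nn; move: IH.
  set a := \sum_(i < n) s i; set b := \sum_(i < n) t i.
  set C := \sum_(i < n0) _ => IH Hn.
  have -> : a + s n - l * (b + t n) = (a - l * b) + (s n - l * t n) by ring.
  by apply: (le_trans (ler_normD _ _)); lra.
rewrite mulr_sumr -sumrB; apply: (le_trans (ler_norm_sum _ _ _)).
apply: ler_wpDl; first by rewrite mulr_ge0 ?sumr_ge0// ltW.
rewrite (big_ord_widen _ (fun i => `|s i - l * t i|) nn).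
rewrite [leRHS](bigID (fun i : 'I_n0 => (i < n.+1)%N))/= lerDl.
by apply: sumr_ge0 => i _.
Qed.

(** Fekete's lemma, with the limit as a linear lower bound and, up to a
    constant, as a linear upper bound. *)
Lemma fekete u :
  (forall n, 0 <= u n) -> (forall n m, u (n + m)%N <= u n + u m) ->
  exists h, [/\ 0 <= h, forall n, h * n%:R <= u n &
    forall e, 0 < e -> exists C, forall n, u n <= (h + e) * n%:R + C].
Proof.
move=> u0 usub.
pose E := [set u n.+1 / n.+1%:R | n in [set: nat]].
have E0 : E !=set0 by exists (u 1%N / 1); exists 0%N.
have lbE : lbound E 0 by move=> _ [n _ <-]; rewrite divr_ge0.
have hE : has_inf E by split => //; exists 0.
exists (inf E); split.
- exact: lb_le_inf.
- case=> [|n]; first by rewrite mulr0.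
  rewrite -ler_pdivlMr ?ltr0Sn//; apply: ge_inf; first by exists 0.
  by exists n.
move=> e e0; have [_ [k _ <-] uk] := inf_adherent e0 hE.
exists (\sum_(i < k.+1) u i) => n.
have {}uk : u k.+1 <= (inf E + e) * k.+1%:R.
  by rewrite -ler_pdivrMr ?ltr0Sn// ltW.
have h0 : 0 <= inf E by exact: lb_le_inf.
have [m] := ubnP n; elim: m n => // m IH n nm.
case: (ltnP n k.+1) => nk.
  rewrite (bigD1 (Ordinal nk))//= addrCA lerDl addr_ge0 ?sumr_ge0//.
  by rewrite mulr_ge0//; lra.
have {}IH := IH (n - k.+1)%N ltac:(lia).
rewrite -(subnKC nk) natrD mulrDr; apply: (le_trans (usub _ _)).
by move: uk IH; move: (u (n - _)%N) => v; lra.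
Qed.

End Asymptotics.

(** * Levels and balls of a tree as lists of words *)

Lemma uniq_flatten_map (I J : eqType) (F : J -> seq I) (js : seq J) :
  uniq js -> (forall j, uniq (F j)) ->
  (forall j j' v, v \in F j -> v \in F j' -> j = j') ->
  uniq (flatten [seq F j | j <- js]).
Proof.
move=> + uF disj; elim: js => //= j js IH /andP[jjs /IH ujs].
rewrite cat_uniq uF ujs andbT/=; apply/hasPn => v /flatten_mapP[j' j'js vj'].
by apply: contra jjs => vj; rewrite (disj _ _ _ vj vj').
Qed.

Section TreeWords.
Variable d : nat.
Implicit Types (T S : set (seq 'I_d)) (v : seq 'I_d).
Local Notation ball := Defs.ball.
Local Open Scope nat_scope.

Definition level_words T (n : nat) : seq (seq 'I_d) :=
  [seq tval w | w <- enum (level T n)].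

Definition words_below T (n : nat) : seq (seq 'I_d) :=
  flatten [seq level_words T i | i <- iota 0 n].

Lemma mem_level_words T n v :
  (v \in level_words T n) = (size v == n) && `[< T v >].
Proof.
apply/mapP/andP => [[w]|[/eqP <- Tv]].
  by rewrite mem_enum !inE => Tw ->; rewrite size_tuple; split => //; apply/asboolP.
by exists (in_tuple v) => //; rewrite mem_enum inE.
Qed.

Lemma level_words_uniq T n : uniq (level_words T n).
Proof. by rewrite map_inj_uniq ?enum_uniq//; exact: val_inj. Qed.

Lemma size_level_words T n : size (level_words T n) = #|level T n|.
Proof. by rewrite size_map -cardE. Qed.

Lemma words_belowD T n m : words_below T (n + m) =
  words_below T n ++ flatten [seq level_words T i | i <- iota n m].
Proof. by rewrite /words_below iotaD add0n map_cat flatten_cat. Qed.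

Lemma words_belowS T n : words_below T n.+1 = words_below T n ++ level_words T n.
Proof. by rewrite -addn1 words_belowD /= cats0. Qed.

Lemma mem_levels T (r : seq nat) v :
  (v \in flatten [seq level_words T i | i <- r]) = (size v \in r) && `[< T v >].
Proof.
elim: r => [|i r IH] //=; rewrite mem_cat mem_level_words IH in_cons.
by rewrite andb_orl eq_sym.
Qed.

Lemma levels_uniq T (r : seq nat) :
  uniq r -> uniq (flatten [seq level_words T i | i <- r]).
Proof.
move=> ur; apply: uniq_flatten_map => // [i|i j v]; first exact: level_words_uniq.
by rewrite !mem_level_words => /andP[/eqP <- _] /andP[/eqP <- _].
Qed.

Lemma mem_words_below T n v : (v \in words_below T n) = (size v < n) && `[< T v >].
Proof. by rewrite mem_levels mem_iota. Qed.

Lemma words_below_uniq T n : uniq (words_below T n).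
Proof. exact/levels_uniq/iota_uniq. Qed.

Lemma size_words_below T n :
  size (words_below T n) = \sum_(i < n) #|level T i|.
Proof.
elim: n => [|n IH]; first by rewrite big_ord0.
by rewrite words_belowS size_cat IH size_level_words big_ord_recr.
Qed.

Lemma card_ball T n : #|ball T n| = size (words_below T n.+1).
Proof.
rewrite cardE -(size_map val); apply: perm_size; apply: uniq_perm.
- by rewrite map_inj_uniq ?enum_uniq//; exact: val_inj.
- exact: words_below_uniq.
move=> v; rewrite mem_words_below ltnS; apply/mapP/andP => [[w]|[vn Tv]].
  by rewrite mem_enum !inE => Tw ->; rewrite size_bseq; split => //; apply/asboolP.
by exists (Bseq vn) => //; rewrite mem_enum inE.
Qed.

Lemma card_ballI T S n : S `<=` T ->
  #|(ball S n :&: ball T n)%SET| = size (words_below S n.+1).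
Proof.
move=> ST; rewrite -card_ball; apply: eq_card => v; rewrite !inE.
by apply: andb_idr => /asboolP /ST ?; apply/asboolP.
Qed.

Lemma card_patterns (A : finType) (X : set (nat -> A)) T n :
  #|patterns X T n| = traces (tree_shift X T) (words_below T n.+1).
Proof.
pose F := [seq val (val g) | g : {g : n.-bseq 'I_d | g \in ball T n}].
have memF : F =i words_below T n.+1.
  move=> v; rewrite mem_words_below ltnS; apply/mapP/andP => [[g _ ->]|[vn Tv]].
    by rewrite size_bseq; split => //; have := valP g; rewrite inE.
  have vb : Bseq vn \in ball T n by rewrite inE.
  by exists (exist (fun g : n.-bseq _ => g \in ball T n) _ vb); rewrite ?mem_enum.
have -> : traces (tree_shift X T) (words_below T n.+1) = traces (tree_shift X T) F.
  by apply/eqP; rewrite eqn_leq !traces_sub// => v; rewrite memF.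
pose word (p : {ffun {g : n.-bseq 'I_d | g \in ball T n} -> A}) :=
  [seq p g | g <- enum {: {g : n.-bseq 'I_d | g \in ball T n}}].
have word_inj : injective word.
  move=> p q /eq_in_map pq; apply/ffunP => g; apply: pq.
  by rewrite mem_enum.
rewrite cardE -(size_map word); apply: perm_size; apply: uniq_perm.
- by rewrite map_inj_uniq ?enum_uniq.
- exact: trace_words_uniq.
move=> w; apply/mapP/trace_wordsP => [[p]|[x Xx <-]].
  rewrite mem_enum inE => /asboolP[x Xx px] ->; exists x => //.
  by rewrite -map_comp; apply: eq_map => g /=; rewrite px.
exists [ffun g => x (val (val g))].
  by rewrite mem_enum inE; apply/asboolP; exists x => // g; rewrite ffunE.
by rewrite /word -map_comp; apply: eq_map => g /=; rewrite ffunE.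
Qed.

End TreeWords.

(** * Entropy of a one-sided shift *)

Section LnNat.
Variable R : realType.

Lemma ln_nat_ge0 (n : nat) : 0 <= ln n%:R :> R.
Proof. by case: n => [|n]; [rewrite ln0|rewrite ln_ge0// ler1n]. Qed.

Lemma ln_nat_le (m n : nat) : (0 < m)%N -> (m <= n)%N -> ln m%:R <= ln n%:R :> R.
Proof.
move=> m0 mn; have n0 : (0 < n)%N := leq_trans m0 mn.
by rewrite ler_ln ?posrE ?ltr0n// ler_nat.
Qed.

Lemma ln_natM (m n : nat) : (0 < m)%N -> (0 < n)%N ->
  ln (m * n)%N%:R = ln m%:R + ln n%:R :> R.
Proof. by move=> m0 n0; rewrite natrM lnM ?posrE ?ltr0n. Qed.

Lemma ln_natX (m n : nat) : (0 < m)%N -> ln (m ^ n)%N%:R = n%:R * ln m%:R :> R.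
Proof. by move=> m0; rewrite natrX lnXn ?ltr0n// mulr_natl. Qed.

Lemma ln_nat_prod (I : Type) (r : seq I) (f : I -> nat) :
  (forall i, 0 < f i)%N ->
  ln (\prod_(i <- r) f i)%N%:R = \sum_(i <- r) ln (f i)%:R :> R.
Proof.
move=> f0; elim: r => [|i r IH]; first by rewrite !big_nil ln1.
by rewrite !big_cons ln_natM ?IH// prodn_gt0.
Qed.

End LnNat.

Lemma nat_unbounded (R : realType) (C : R) :
  exists n0, forall n, (n0 <= n)%N -> C <= n%:R.
Proof.
exists (Num.bound `|C|) => n; rewrite -(ler_nat R); apply: le_trans.
by rewrite (le_trans (ler_norm C))// ltW// archi_boundP.
Qed.

Lemma nat_mul_bounded (R : realType) (x c : R) :
  (forall t : nat, t%:R * x <= c) -> x <= 0.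
Proof.
move=> xc; rewrite leNgt; apply/negP => x0.
have c0 : 0 <= c by have := xc 0%N; rewrite mul0r.
have := xc (Num.bound (c / x)); rewrite leNgt => /negP; apply.
by rewrite -ltr_pdivrMr// archi_boundP// divr_ge0// ltW.
Qed.

Section ShiftEntropy.
Variables (R : realType) (A : finType) (X : set (nat -> A)).
Hypothesis X_inv : @shift_map A @` X `<=` X.

Lemma shift_iter (x : nat -> A) (k : nat) : X x -> X (fun j => x (k + j)%N).
Proof.
move=> Xx; elim: k => [//|k IH]; apply: X_inv; exists (fun j => x (k + j)%N) => //.
by apply/funext => j; rewrite /shift_map addnS.
Qed.

Lemma card_words (n : nat) : #|words X n| = traces X (iota 0 n).
Proof.
rewrite cardE -(size_map val); apply: perm_size; apply: uniq_perm.
- by rewrite map_inj_uniq ?enum_uniq//; exact: val_inj.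
- exact: trace_words_uniq.
move=> w; apply/mapP/trace_wordsP => [[u]|[x Xx <-]].
  rewrite mem_enum inE => /asboolP[x Xx [k ux]] ->.
  exists (fun j => x (k + j)%N); first exact: shift_iter.
  rewrite -[RHS](map_tnth_enum u) -val_enum_ord -map_comp.
  by apply: eq_map => j /=; rewrite ux.
exists (map_tuple x (iota_tuple n 0)) => //.
rewrite mem_enum inE; apply/asboolP; exists x => //; exists 0%N => j.
by rewrite tnth_map (tnth_nth 0%N)/= nth_iota.
Qed.

Lemma traces_iota_shift (a k n : nat) :
  (traces X (iota (a + k) n) <= traces X (iota a n))%N.
Proof.
apply: traces_le => x Xx; exists (fun j => x (k + j)%N); first exact: shift_iter.
by rewrite addnC iotaDl -map_comp.
Qed.

Lemma traces_iotaD (a n m : nat) :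
  (traces X (iota a (n + m)) <= traces X (iota a n) * traces X (iota a m))%N.
Proof.
rewrite iotaD (leq_trans (traces_cat _ _ _))// leq_mul//.
exact: traces_iota_shift.
Qed.

Hypothesis X0 : X !=set0.

Lemma traces_iota_le_late (a n t : nat) :
  (traces X (iota 0 (a + n * t)) <=
   traces X (iota 0 a) * traces X (iota a n) ^ t)%N.
Proof.
rewrite iotaD add0n (leq_trans (traces_cat _ _ _))// leq_mul//.
elim: t => [|t IH]; first by rewrite muln0 (leq_trans (traces_le_card _ _)).
by rewrite mulnS expnS (leq_trans (traces_iotaD _ _ _))// leq_mul.
Qed.

(** The lower bound holds for the words seen at any given position [a], not
    just at the start: the windows at position [a] generate, up to the first
    [a] letters, all words of the shift. *)
Lemma shift_entropy_bounds : exists h : R, [/\ 0 <= h,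
  shift_entropy R X = h%:E,
  forall a n, h * n%:R <= ln (traces X (iota a n))%:R &
  forall e, 0 < e -> exists C, forall n,
    ln (traces X (iota 0 n))%:R <= (h + e) * n%:R + C].
Proof.
pose u a n : R := ln (traces X (iota a n))%:R.
have u0 a n : 0 <= u a n by exact: ln_nat_ge0.
have usub a n m : u a (n + m)%N <= u a n + u a m.
  rewrite /u -ln_natM ?traces_gt0//.
  by apply: ln_nat_le; rewrite ?traces_gt0// traces_iotaD.
have [h [h0 hlow hup]] := fekete (u0 0%N) (usub 0%N).
exists h; split => //.
- apply/cvg_lim => //; apply: cvg_EFin; first by apply: nearW.
  rewrite (_ : _ \o _ = fun n => u 0%N n / n%:R); last first.
    by apply/funext => n /=; rewrite card_words.
  apply: linear_error_cvg => [C|e e0]; first exact: nat_unbounded.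
  have [C HC] := hup e e0; exists C, 0%N => n _.
  have := HC n; have := hlow n; have := u0 0%N n => ? ? ?.
  by rewrite ger0_norm; lra.
- move=> a n; rewrite -subr_le0; apply: (nat_mul_bounded (c := u 0%N a - h * a%:R)) => t.
  have : u 0%N (a + n * t)%N <= u 0%N a + t%:R * u a n.
    rewrite /u -ln_natX ?traces_gt0// -ln_natM ?expn_gt0 ?traces_gt0//.
    by apply: ln_nat_le; rewrite ?traces_gt0// traces_iota_le_late.
  move/(le_trans (hlow _)); rewrite natrD natrM -/(u a n).
  by move: (u a n) (u 0%N a) => v w; lra.
Qed.

End ShiftEntropy.

Lemma shift_entropy0 (R : realType) (A : finType) :
  shift_entropy R (set0 : set (nat -> A)) = 0%E.
Proof.
rewrite /shift_entropy (_ : (fun n => _) = fun=> 0%E); first exact: lim_cst.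
apply/funext => n; rewrite (_ : words _ n = finset.set0) ?cards0 ?ln0 ?mul0r//.
by apply/setP => w; rewrite !inE; apply/asboolP => -[x []].
Qed.

(** * Vertices on infinite rays and the upper bound on the entropy *)

Section GrowWord.
Variables (d : nat) (f : seq 'I_d -> 'I_d).
Local Open Scope nat_scope.

Definition grow (v : seq 'I_d) : seq 'I_d := rcons v (f v).

Lemma size_iter_grow (s : nat) (v : seq 'I_d) : size (iter s grow v) = size v + s.
Proof. by elim: s => [|s IH]; rewrite ?addn0// iterS size_rcons IH addnS. Qed.

Lemma iter_grow_cat (s n : nat) (v : seq 'I_d) :
  s <= n -> exists w, iter n grow v = iter s grow v ++ w.
Proof.
move=> /subnK <-; elim: (n - s) => [|m [w IH]]; first by exists [::]; rewrite cats0.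
exists (rcons w (f (iter s grow v ++ w))).
by rewrite addSn iterS IH /grow rcons_cat.
Qed.

Lemma take_iter_grow (s n : nat) (v : seq 'I_d) :
  s <= n -> take (size v + s) (iter n grow v) = iter s grow v.
Proof. by move=> sn; have [w ->] := iter_grow_cat v sn; rewrite -size_iter_grow take_size_cat. Qed.

End GrowWord.

Section LivePart.
Variables (d : nat) (T : set (seq 'I_d)).
Local Open Scope nat_scope.

Definition live_part : set (seq 'I_d) :=
  [set v | exists2 r, ray T r & v = mkseq r (size v)].

Lemma live_part_sub : live_part `<=` T.
Proof. by move=> v [r Tr ->]. Qed.

Lemma take_mkseq (r : nat -> 'I_d) (n m : nat) : n <= m -> take n (mkseq r m) = mkseq r n.
Proof. by move=> nm; rewrite /mkseq -map_take take_iota (minn_idPl nm). Qed.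

Lemma live_part_succ (i0 : 'I_d) : exists f : seq 'I_d -> 'I_d,
  forall v, live_part v -> live_part (grow f v).
Proof.
have /choice[f Hf] : forall v, exists i, live_part v -> live_part (rcons v i).
  move=> v; case: (pselect (live_part v)) => [[r Tr vr]|nv]; last by exists i0.
  by exists (r (size v)) => _; exists r => //; rewrite size_rcons mkseqS -vr.
by exists f.
Qed.

Lemma iter_grow_live (f : seq 'I_d -> 'I_d) (v : seq 'I_d) :
  is_tree T -> (forall n, T (iter n (grow f) v)) -> live_part v.
Proof.
move=> [_ Tpre] Tv.
pose r j := nth (f [::]) (iter j.+1 (grow f) v) j.
have rE n : mkseq r n = take n (iter n (grow f) v).
  apply: (@eq_from_nth _ (f [::])) => [|j].
    by rewrite size_mkseq size_take size_iter_grow; case: ltnP; lia.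
  rewrite size_mkseq => jn; rewrite nth_mkseq// nth_take// /r.
  have [w ->] := iter_grow_cat f v jn.
  by rewrite nth_cat size_iter_grow ifT//; lia.
exists r => [n|].
  by apply: (Tpre _ (drop n (iter n (grow f) v))); rewrite rE cat_take_drop.
by rewrite rE -[X in take X](addn0 (size v)) take_iter_grow.
Qed.

Lemma leafless_live : is_tree T -> leafless T -> live_part = T.
Proof.
move=> treeT nol; apply/seteqP; split; first exact: live_part_sub.
have [i0 _] := nol _ treeT.1.
have /choice[f Hf] : forall v, exists i, T v -> T (rcons v i).
  move=> v; case: (pselect (T v)) => [/nol[i Ti]|]; last by exists i0.
  by exists i.
move=> v Tv; apply: (iter_grow_live (f := f)) => // n.
by elim: n => //= n; exact: Hf.
Qed.

Lemma live_level_nondecreasing (n : nat) :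
  #|level live_part n| <= #|level live_part n.+1|.
Proof.
rewrite -!size_level_words; case E: (level_words live_part n) => [//|v l].
have /[!mem_level_words]/andP[_ /asboolP[r _ _]] :
  v \in level_words live_part n by rewrite E mem_head.
have [f Hf] := live_part_succ (r 0).
rewrite -E -(size_map (grow f)); apply: uniq_leq_size.
  rewrite map_inj_uniq ?level_words_uniq// => u w /eqP.
  by rewrite /grow eqseq_rcons => /andP[/eqP].
move=> _ /mapP[u + ->]; rewrite !mem_level_words size_rcons.
by move=> /andP[/eqP -> /asboolP /Hf Lu]; rewrite eqxx; apply/asboolP.
Qed.

Variables (A : finType) (X : set (nat -> A)).
Hypothesis X_inv : @shift_map A @` X `<=` X.

(** One step of the covering argument: the [k] levels from [n] on are covered
    by one path of length [k] below each live vertex of level [n], up to the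
    remaining vertices, whose labels are counted as free. *)
Lemma traces_tree_block (i0 : 'I_d) (n k : nat) :
  traces (tree_shift X T) (words_below T (n + k)) <=
  traces (tree_shift X T) (words_below T n) *
  (traces X (iota 0 k) ^ #|level live_part n| *
   #|A| ^ (\sum_(i <- iota n k) #|level T i| - #|level live_part n| * k)).
Proof.
have [f Hf] := live_part_succ i0.
pose path h := [seq iter s (grow f) h | s <- iota 0 k].
pose heads := level_words live_part n.
pose G := flatten [seq level_words T i | i <- iota n k].
pose paths := flatten [seq path h | h <- heads].
pose rest := [seq v <- G | v \notin paths].
have live_iter h s : h \in heads -> live_part (iter s (grow f) h).
  rewrite mem_level_words => /andP[_ /asboolP Lh].
  by elim: s => //= s; exact: Hf.
have size_head h : h \in heads -> size h = n.
  by rewrite mem_level_words => /andP[/eqP].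
have paths_uniq : uniq paths.
  apply: (allpairs_uniq (f := fun h s => iter s (grow f) h)).
  - exact: level_words_uniq.
  - exact: iota_uniq.
  move=> [h s] [h' s'] /allpairsP[[a b] /= [ha _ [-> ->]]].
  move=> /allpairsP[[a' b'] /= [ha' _ [-> ->]]] e.
  have /eqP := congr1 size e.
  rewrite !size_iter_grow !size_head// eqn_add2l => /eqP bb; rewrite bb in e *.
  congr (_, _); rewrite -[LHS](take_iter_grow f a (leq0n b')).
  by rewrite -[RHS](take_iter_grow f a' (leq0n b')) e !size_head.
have size_paths : size paths = #|level live_part n| * k.
  by rewrite -size_level_words (size_allpairs (fun h s => iter s (grow f) h)) size_iota.
have pathsG : {subset paths <= G}.
  move=> v /allpairsP[[h s] /= [hh]]; rewrite mem_iota /= add0n => sk ->.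
  rewrite mem_levels mem_iota size_iter_grow size_head// leq_addr ltn_add2l sk/=.
  by apply/asboolP/live_part_sub/live_iter.
have size_rest : size rest = \sum_(i <- iota n k) #|level T i| - #|level live_part n| * k.
  have -> : \sum_(i <- iota n k) #|level T i| = size G.
    rewrite /G size_flatten sumnE !big_map; apply: eq_bigr => i _.
    by rewrite size_level_words.
  rewrite -size_paths -(count_predC (mem paths) G) -!size_filter.
  rewrite (_ : size [seq v <- G | mem paths v] = size paths) ?addKn//.
  apply: perm_size; apply: uniq_perm => //.
    by rewrite filter_uniq// levels_uniq// iota_uniq.
  by move=> v; rewrite mem_filter /= andb_idr//; exact: pathsG.
have path_bound h : h \in heads ->
    traces (tree_shift X T) (path h) <= traces X (iota 0 k).
  move=> hh; apply: traces_le => x Xx.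
  have [r Tr rE] := live_iter h k hh.
  exists (fun j => x (mkseq r (size h + j))).
    exact: (shift_iter X_inv (size h) (Xx r Tr)).
  rewrite -map_comp; apply/eq_in_map => s; rewrite mem_iota /= => sk.
  have sk' : s <= k by exact: ltnW.
  rewrite /= -(take_iter_grow f h sk') rE take_mkseq//.
  by rewrite size_iter_grow leq_add2l.
have cover : {subset words_below T (n + k) <= words_below T n ++ (paths ++ rest)}.
  move=> v; rewrite words_belowD !mem_cat => /orP[->//|vG].
  by rewrite mem_filter vG andbT; case: (v \in paths); rewrite orbT.
rewrite (leq_trans (traces_sub _ cover))// (leq_trans (traces_cat _ _ _))//.
rewrite leq_mul// (leq_trans (traces_cat _ _ _))// leq_mul//; last first.
  by rewrite -size_rest traces_le_card.
rewrite -size_level_words -/heads /paths.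
elim: (heads) path_bound => [|h l IH] Hl /=.
  by rewrite (leq_trans (traces_le_card _ _)).
rewrite expnS (leq_trans (traces_cat _ _ _))// leq_mul ?Hl ?mem_head// IH// => h' h'l.
by rewrite Hl// in_cons h'l orbT.
Qed.

End LivePart.

(** The entropy of an empty tree-shift is 0, because of the convention on the
    logarithm of 0. *)
Lemma tree_shift_nonempty (R : realType) (d : nat) (A : finType)
    (X : set (nat -> A)) (T : set (seq 'I_d)) :
  (0 < tree_entropy R X T)%E -> tree_shift X T !=set0.
Proof.
apply: contraPP => Y0; apply/negP; rewrite -leNgt.
apply: (@limn_esup_le_near _ _ _ 0%N) => n _.
rewrite card_patterns (_ : traces _ _ = 0%N) ?ln0 ?mul0r//.
apply/eqP; rewrite /traces size_eq0; case E: trace_words => [//|w s].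
have /trace_wordsP[x Yx _] : w \in trace_words (tree_shift X T) (words_below T n.+1).
  by rewrite E mem_head.
by case: Y0; exists x.
Qed.

Section Unexpandable.
Variables (R : realType) (d : nat) (T : set (seq 'I_d)).
Local Notation t n := (#|level T n|%:R : R).
Local Notation l n := (#|level (live_part T) n|%:R : R).

Definition mostly_live : Prop := forall e : R, 0 < e ->
  exists n0, forall n, (n0 <= n)%N -> t n - l n <= e * t n.

Lemma leafless_mostly_live : is_tree T -> leafless T -> mostly_live.
Proof.
move=> treeT leaflessT e e0; exists 0%N => n _.
by rewrite leafless_live// subrr mulr_ge0// ltW.
Qed.

Hypothesis unexpT : unexpandable R T.

Lemma unexpandable_level_gt0 :
  exists n0, forall n, (n0 <= n)%N -> (0 < #|level T n|)%N.
Proof.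
have h0 : (0 : R) < 2^-1 by lra.
have [n0 H] := (cvgnP _ _).1 unexpT _ h0.
exists n0 => n /H; rewrite lt0n; apply: contraTneq => ->.
by rewrite invr0 mulr0 sub0r normrN1 -ltNge; lra.
Qed.

Lemma unexpandable_step (e : R) (k : nat) : 0 < e ->
  exists n0, forall n, (n0 <= n)%N -> `|t (n + k)%N - t n| <= e * t n.
Proof.
elim: k e => [|k IH] e e0.
  by exists 0%N => n _; rewrite addn0 subrr normr0 mulr_ge0// ltW.
have e3 : 0 < Num.min (e / 3) 1 by rewrite lt_min ltr01 andbT; lra.
have [n1 H1] := (cvgnP _ _).1 unexpT _ e3.
have [n2 H2] := IH _ e3; have [n3 H3] := unexpandable_level_gt0.
exists (n1 + n2 + n3)%N => n nn; rewrite addnS.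
have t0 : 0 < t (n + k)%N by rewrite ltr0n; apply: H3; lia.
have := H1 (n + k)%N ltac:(lia); have := H2 n ltac:(lia).
have le1 : Num.min (e / 3) 1 <= 1 by rewrite ge_min lexx orbT.
have le3 : Num.min (e / 3) 1 <= e / 3 by rewrite ge_min lexx.
move: (Num.min _ _) e3 le1 le3 => c c0 c1 ce {H1 H2 H3 IH}.
have tn0 : 0 <= t n by [].
rewrite !ler_norml => /andP[a1 a2].
have -> : t (n + k).+1 / t (n + k)%N - 1 = (t (n + k).+1 - t (n + k)%N) / t (n + k)%N.
  by field; rewrite gt_eqF.
rewrite ler_pdivlMr// ler_pdivrMr// => /andP[b1 b2].
move: a1 a2 b1 b2 t0 tn0.
move: (t n) (t (n + k)%N) (t (n + k).+1) => x y z a1 a2 b1 b2 y0 x0.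
by apply/andP; split; nra.
Qed.

Lemma words_below_unbounded (C : R) :
  exists n0, forall n, (n0 <= n)%N -> C <= (size (words_below T n))%:R.
Proof.
have [n0 H] := unexpandable_level_gt0; have [n1 H1] := nat_unbounded C.
exists (n0 + n1)%N => n nn; have grows m : (m - n0 <= size (words_below T m))%N.
  rewrite size_words_below; elim: m => [|m IH] //; rewrite big_ord_recr/=.
  move: IH (H m); move: #|level T m| (\sum_(i < m) _)%N => a b IH Hm.
  by case: (leqP n0 m) => h; [have := Hm h; lia|lia].
apply: le_trans (H1 (n - n0)%N _) _; first lia.
by rewrite ler_nat.
Qed.

Hypothesis liveT : mostly_live.

(** In a block of [k] late levels all the levels have nearly the same size, so
    that the paths of length [k] below the live vertices of the first level
    leave out a small proportion of the block. *)
Lemma live_block (e : R) (k : nat) : 0 < e ->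
  exists n0, forall n, (n0 <= n)%N ->
    \sum_(i <- iota n k) t i - l n * k%:R <= e * \sum_(i <- iota n k) t i.
Proof.
move=> e0; pose c := Num.min (e / 4) (1 / 2).
have c0 : 0 < c by rewrite lt_min; apply/andP; split; lra.
have c1 : c <= 1 / 2 by rewrite ge_min lexx orbT.
have c2 : c <= e / 4 by rewrite ge_min lexx.
have [n1 H1] := liveT c0.
elim: k => [|k [n2 IH]].
  by exists 0%N => n _; rewrite big_nil !mulr0 subr0.
have [n3 H3] := unexpandable_step k c0.
exists (n1 + n2 + n3)%N => n nn.
rewrite -(addn1 k) iotaD big_cat/= big_seq1 natrD.
have := H1 n ltac:(lia); have := H3 n ltac:(lia); have := IH n ltac:(lia).
rewrite ler_norml; move: (\sum_(i <- iota n k) _) => s.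
have : 0 <= t n by []. have : 0 <= t (n + k)%N by [].
move: (t n) (t (n + k)%N) (l n) => x y z x0 y0 h1 /andP[h2 h3] h4.
have : x <= 2 * y by nra.
nra.
Qed.

Variables (A : finType) (X : set (nat -> A)).
Hypothesis X_inv : @shift_map A @` X `<=` X.

Lemma live_ray : exists r, ray T r.
Proof.
have h0 : (0 : R) < 2^-1 by lra.
have [n0 H0] := liveT h0; have [n1 H1] := unexpandable_level_gt0.
have := H0 (n0 + n1)%N (leq_addr _ _); have := H1 (n0 + n1)%N (leq_addl _ _).
rewrite -(ltr0n R) => tn ln.
have : (0 < #|level (live_part T) (n0 + n1)|)%N by rewrite -(ltr0n R); lra.
rewrite -size_level_words -has_predT => /hasP[v].
by rewrite mem_level_words => /andP[_ /asboolP[r Tr _]] _; exists r.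
Qed.

Lemma sum_live_le (n k : nat) :
  (#|level (live_part T) n| * k <= \sum_(i <- iota n k) #|level T i|)%N.
Proof.
rewrite -[X in (_ * X)%N](size_iota n k) -sum1_size big_distrr/=.
rewrite big_seq [leqRHS]big_seq; apply: leq_sum => i.
rewrite mem_iota muln1 => /andP[ni _].
have live_le m : (#|level (live_part T) m| <= #|level T m|)%N.
  apply: subset_leq_card; apply/fintype.subsetP => w; rewrite !inE.
  exact: live_part_sub.
apply: leq_trans (live_le i); rewrite -(subnKC ni).
elim: (i - n)%N => [|m IH]; first by rewrite addn0.
by rewrite addnS (leq_trans IH)// live_level_nondecreasing.
Qed.

(** The covering argument, iterated over consecutive blocks of [k] levels. *)
Lemma tree_traces_growth (h : R) : tree_shift X T !=set0 -> X !=set0 ->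
  (forall e, 0 < e -> exists C, forall n,
    ln (traces X (iota 0 n))%:R <= (h + e) * n%:R + C) ->
  0 <= h ->
  forall e, 0 < e -> exists C, forall n,
    ln (traces (tree_shift X T) (words_below T n))%:R <=
      (h + e) * (size (words_below T n))%:R + C.
Proof.
move=> Y0 X0 hup h0 e e0.
pose p n : R := ln (traces (tree_shift X T) (words_below T n))%:R.
have p0 n : 0 <= p n by exact: ln_nat_ge0.
pose a : R := ln #|A|%:R.
have a0 : 0 <= a by exact: ln_nat_ge0.
have [r Tr] := live_ray.
have A0 : (0 < #|A|)%N.
  by have [x Xx] := X0; apply/card_gt0P; exists (x 0%N).
(* the length of the blocks: long enough for the words of length k to be
   counted by exp ((h + e / 2) k) *)
have e4 : 0 < e / 4 by lra.
have [C1 HC1] := hup _ e4; have [k1 Hk1] := nat_unbounded (C1 / (e / 4)).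
pose k := k1.+1.
have beta : ln (traces X (iota 0 k))%:R <= (h + e / 2) * k%:R.
  have := HC1 k; have := Hk1 k (leqnSn _); rewrite ler_pdivrMr//.
  by lra.
(* the proportion of free vertices, each of which costs a = ln #|A| *)
have c0 : 0 < e / 2 / (a + 1) by rewrite divr_gt0//; lra.
have [n0 Hn0] := live_block k c0.
have step n : (n0 <= n)%N ->
    p (n + k)%N <= p n + (h + e) * \sum_(i <- iota n k) t i.
  move=> nn; have := traces_tree_block T X_inv (r 0%N) n k.
  set L := #|level (live_part T) n|; set g := (\sum_(i <- _) _)%N => block.
  have gE : \sum_(i <- iota n k) t i = g%:R by rewrite natr_sum.
  have Lg : (L * k <= g)%N by exact: sum_live_le.
  have := Hn0 n nn; rewrite gE -/L -natrM -natrB// => gap.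
  have /(ln_nat_le R (traces_gt0 _ Y0)) := block.
  rewrite ln_natM ?traces_gt0 ?muln_gt0 ?expn_gt0 ?traces_gt0 ?A0//.
  rewrite ln_natM ?expn_gt0 ?traces_gt0 ?A0// !ln_natX ?traces_gt0//.
  rewrite -/(p _) -/(p n) -/a => /le_trans; apply.
  rewrite lerD2l.
  have -> : (h + e) * g%:R = (h + e / 2) * g%:R + e / 2 * g%:R by field.
  apply: lerD.
    apply: (@le_trans _ _ (L%:R * ((h + e / 2) * k%:R))); first by rewrite ler_wpM2l.
    rewrite mulrCA -natrM ler_wpM2l ?ler_nat//; lra.
  apply: (@le_trans _ _ (e / 2 / (a + 1) * g%:R * a)); first by rewrite ler_wpM2r.
  have -> : e / 2 / (a + 1) * g%:R * a = (e / 2 * g%:R) * (a / (a + 1)).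
    by field; rewrite gt_eqF//; lra.
  rewrite ler_piMr ?mulr_ge0//; first lra.
  by rewrite ler_pdivrMr; lra.
exists (\sum_(i < n0 + k) p i) => n.
have [m] := ubnP n; elim: m n => // m IH n nm.
case: (ltnP n (n0 + k)) => nk.
  rewrite (bigD1 (Ordinal nk))//= addrCA lerDl addr_ge0 ?sumr_ge0//.
  by rewrite mulr_ge0//; lra.
have nE : n = ((n - k) + k)%N by rewrite subnK//; lia.
have {}IH := IH (n - k)%N ltac:(rewrite /k; lia).
have := step (n - k)%N ltac:(lia); rewrite -nE.
move/le_trans; apply; rewrite [in leRHS]nE words_belowD size_cat natrD.
rewrite [in leRHS]size_flatten sumnE !big_map natr_sum.
under [in leRHS]eq_bigr do rewrite size_level_words.
by rewrite -/(p _) in IH; rewrite mulrDr; lra.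
Qed.

(** A tree whose levels grow at ratio one is essentially a disjoint union of
    long paths, so its patterns are not richer than the words of [X]. *)
Lemma tree_entropy_le : (tree_entropy R X T <= shift_entropy R X)%E.
Proof.
have [r Tr] := live_ray.
have [[x Yx]|Y0] := pselect (tree_shift X T !=set0); last first.
  apply: (@le_trans _ _ 0%E).
    by rewrite leNgt; apply/negP => /tree_shift_nonempty.
  have [X0|X0] := pselect (X !=set0).
    by have [h [h0 -> _ _]] := shift_entropy_bounds R X_inv X0; rewrite lee_fin.
  suff -> : X = set0 by rewrite shift_entropy0.
  by apply/seteqP; split => // x Xx; case: X0; exists x.
have X0 : X !=set0 by exists (fun j => x (mkseq r j)); exact: Yx.
have Y0 : tree_shift X T !=set0 by exists x.
have [h [h0 -> _ hup]] := shift_entropy_bounds R X_inv X0.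
apply/lee_addgt0Pr => e e0; have e2 : 0 < e / 2 by lra.
have [C HC] := tree_traces_growth Y0 X0 hup h0 e2.
have [n0 Hn0] := words_below_unbounded (Num.max 1 (C / (e / 2))).
apply: (@limn_esup_le_near _ _ _ n0) => n nn.
have := Hn0 n.+1 (leqW nn); rewrite ge_max => /andP[b1].
rewrite ler_pdivrMr// => bC.
rewrite card_patterns card_ball lee_fin ler_pdivrMr; last by rewrite (lt_le_trans _ b1).
by have := HC n.+1; lra.
Qed.

End Unexpandable.

(** * Words of a Markov-Cayley tree and walks *)

Section MarkovWords.
Variables (d : nat) (M : 'M[bool]_d).
Local Open Scope nat_scope.
Local Notation T := (markov_tree M).
Local Notation E := (fun i j => M i j).

Definition last_in (P : pred 'I_d) (v : seq 'I_d) : bool :=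
  if v is x :: s then P (last x s) else false.

Lemma last_in_rcons P v i : last_in P (rcons v i) = P i.
Proof. by case: v => //= x s; rewrite last_rcons. Qed.

Lemma markov_is_tree : is_tree T.
Proof.
split=> // u v; rewrite /markov_tree/=; case: u => //= x u.
by rewrite cat_path => /andP[].
Qed.

Lemma markov_rcons v i : T (rcons v i) <-> T v /\ (v = [::] \/ last_in (E^~ i) v).
Proof.
rewrite /markov_tree/=; case: v => [|x s] /=; first by split => [_|//]; split; [|left].
rewrite rcons_path; split => [/andP[]|[-> []//]].
by split => //; right.
Qed.

(** The words of length [n + 1] that end in [i], enumerated so as to match the
    recursion of [walks_to]. *)
Fixpoint words_ending (n : nat) (i : 'I_d) : seq (seq 'I_d) :=
  if n is n'.+1 then
    flatten [seq [seq rcons v i | v <- words_ending n' k] |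
             k <- [seq k <- enum 'I_d | M k i]]
  else [:: [:: i]].

Lemma size_words_ending n i : size (words_ending n i) = walks_to E n i.
Proof.
elim: n i => //= n IH i; rewrite size_flatten sumnE !big_map big_filter big_mkcond/=.
rewrite big_enum/=; apply: eq_bigr => k _; rewrite size_map IH.
by case: (M k i); rewrite ?muln1 ?muln0.
Qed.

Lemma mem_words_ending n i v : (v \in words_ending n i) =
  [&& size v == n.+1, sorted E v & last_in (pred1 i) v].
Proof.
elim: n i v => [|n IH] i v /=.
  rewrite inE; case: v => [|x [|y s]]//=; last by rewrite eqseq_cons andbF.
  by rewrite eqseq_cons eqxx andbT.
apply/flatten_mapP/and3P => [[k]|[]].
  rewrite mem_filter => /andP[Mki _] /mapP[u]; rewrite IH => /and3P[/eqP su Su lu] ->.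
  rewrite size_rcons su last_in_rcons/=; split => //.
  have [_] := markov_rcons u i; apply; split => //; right.
  by case: u lu {su Su} => //= x s /eqP ->.
case/lastP: v => // u j; rewrite size_rcons last_in_rcons eqSS => /eqP su Su /eqP ji.
rewrite {j}ji in Su *; have [/(_ Su)[Tu [u0|lu]] _] := markov_rcons u i.
  by rewrite u0 in su.
case: u su Su Tu lu => // x s su Su Tu /= Mi.
exists (last x s); first by rewrite mem_filter Mi mem_enum.
by apply/mapP; exists (x :: s) => //; rewrite IH su eqxx/= eqxx andbT.
Qed.

Lemma words_ending_inj n m i j v :
  v \in words_ending n i -> v \in words_ending m j -> i = j.
Proof.
by rewrite !mem_words_ending; case: v => // x s /and3P[_ _ /eqP<-] /and3P[_ _ /eqP<-].
Qed.

Lemma words_ending_uniq n i : uniq (words_ending n i).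
Proof.
elim: n i => //= n IH i; apply: uniq_flatten_map.
- by rewrite filter_uniq// enum_uniq.
- by move=> k; rewrite map_inj_uniq ?IH//; exact: rcons_injl.
move=> k k' _ /mapP[u uk ->] /mapP[u' uk'] /eqP.
by rewrite eqseq_rcons eqxx andbT => /eqP uu; rewrite -uu in uk'; exact: words_ending_inj uk uk'.
Qed.

Lemma count_last_in (P : pred 'I_d) n :
  count (last_in P) (level_words T n.+1) = \sum_(i | P i) walks_to E n i.
Proof.
have -> : \sum_(i | P i) walks_to E n i =
    size (flatten [seq words_ending n i | i <- [seq i <- enum 'I_d | P i]]).
  rewrite size_flatten sumnE !big_map big_filter big_enum_cond/=.
  by apply: eq_bigr => i _; rewrite size_words_ending.
rewrite -size_filter; apply: perm_size; apply: uniq_perm.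
- by rewrite filter_uniq// level_words_uniq.
- apply: uniq_flatten_map.
  + by rewrite filter_uniq// enum_uniq.
  + by move=> k; exact: words_ending_uniq.
  + by move=> j j' v; exact: words_ending_inj.
move=> v; rewrite mem_filter mem_level_words.
apply/and3P/flatten_mapP => [[Pv /eqP sv /asboolP Tv]|[i]].
  case: v Pv sv Tv => // x s Ps sv Tv; exists (last x s).
    by rewrite mem_filter mem_enum /= andbT.
  by rewrite mem_words_ending sv eqxx /= eqxx andbT.
rewrite mem_filter mem_enum andbT mem_words_ending => Pi /and3P[sv Tv lv].
by split => //; [case: v lv {sv Tv} => //= x s /eqP ->|apply/asboolP].
Qed.

Lemma card_markov_level n : #|level T n.+1| = \sum_i walks_to E n i.
Proof.
rewrite -size_level_words -count_last_in -size_filter; congr size.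
apply/esym/all_filterP/allP => v; rewrite mem_level_words => /andP[/eqP].
by case: v.
Qed.

End MarkovWords.

(** * The lower bound for hereditary shifts on leafless Markov-Cayley trees *)

Section EntryLabelling.
Variables (m d : nat) (X : set (nat -> 'I_m)) (T : set (seq 'I_d)).
Hypothesis X_her : hereditary X.
Local Open Scope nat_scope.

Definition entry (P : pred 'I_d) (v : seq 'I_d) : seq 'I_d := take (find P v).+1 v.

Lemma entry_cat P u w : has P u -> entry P (u ++ w) = entry P u.
Proof.
move=> hu; rewrite /entry find_cat hu take_cat; move: hu; rewrite has_find => fu.
by case: ltnP => // us; rewrite (_ : _.+1 = size u) ?subnn ?take0 ?cats0 ?take_size//; lia.
Qed.

(** Along a ray the word [entry P v] is constant once defined, so the labels
    are, up to zeros at the beginning, those of a single point of [X]. *)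
Lemma entry_labelling (zero : 'I_m) (P : pred 'I_d)
    (z : seq 'I_d -> nat -> 'I_m) :
  val zero = 0 -> (forall b, X (z b)) ->
  tree_shift X T (fun v => if has P v then z (entry P v) (size v) else zero).
Proof.
move=> zero0 Xz r _.
have [b Hb] : exists b, forall j, has P (mkseq r j) -> entry P (mkseq r j) = b.
  have [[j0 h0]|no] := pselect (exists j, has P (mkseq r j)); last first.
    by exists [::] => j hj; case: no; exists j.
  have pre i j : i <= j -> has P (mkseq r i) ->
      entry P (mkseq r j) = entry P (mkseq r i).
    move=> ij hi; rewrite -(cat_take_drop i (mkseq r j)) take_mkseq//.
    exact: entry_cat.
  exists (entry P (mkseq r j0)) => j hj.
  by case/orP: (leq_total j j0) => jj; rewrite ?(pre _ _ jj).
apply: (X_her (Xz b)) => i; case: ifP => [/Hb ->|_]; last by rewrite zero0.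
by rewrite size_mkseq.
Qed.

End EntryLabelling.

Section LeaflessMarkov.
Variables (R : realType) (d : nat) (M : 'M[bool]_d).
Local Notation T := (markov_tree M).
Local Notation E := (fun i j => M i j).
Local Notation t n := (#|level T n|%:R : R).
Hypotheses (unexpT : unexpandable R T) (leaflessT : leafless T).

Definition branching (i : 'I_d) : bool := (1 < \sum_j M i j)%N.

(** No branching is reachable: in a leafless tree, a single ray starts below a
    vertex that ends in such a letter. *)
Definition unary (i : 'I_d) : bool :=
  `[< forall n j, (0 < walks E n i j)%N -> ~~ branching j >].

Lemma markov_succ (i : 'I_d) : exists j, M i j.
Proof.
have [j] := leaflessT (isT : T [:: i]).
by rewrite /markov_tree/= andbT; exists j.
Qed.

Lemma markov_outdegree_gt0 (i : 'I_d) : (0 < \sum_j M i j)%N.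
Proof. by have [j Mij] := markov_succ i; rewrite (bigD1 j)//= Mij. Qed.

Lemma unary_succ (i j : 'I_d) : unary i -> M i j -> unary j.
Proof.
move=> /asboolP ui Mij; apply/asboolP => n k wjk; apply: (ui (1 + n)%N k).
apply: leq_trans (walksM_le _ _ _ _ j _).
by rewrite muln_gt0 wjk andbT/= (bigD1 i)//= eqxx Mij.
Qed.

Lemma unary_inj (i j k : 'I_d) : unary i -> M i j -> M i k -> j = k.
Proof.
move=> /asboolP/(_ 0%N i); rewrite /= eqxx => /(_ isT); rewrite /branching -leqNgt.
move=> + Mij Mik; apply: contraTeq => jk; rewrite -ltnNge (bigD1 j)//= Mij.
by rewrite (bigD1 k)/= 1?eq_sym// Mik.
Qed.

(** Without leaves, each branching vertex adds at least one vertex to the size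
    of the next level. *)
Lemma branching_small (j : 'I_d) (n : nat) : branching j ->
  (walks_to E n j + #|level T n.+1| <= #|level T n.+2|)%N.
Proof.
move=> bj; rewrite !card_markov_level /=.
rewrite exchange_big/=; under [leqRHS]eq_bigr do rewrite -big_distrr/=.
rewrite (bigD1 j)//= addnA [leqRHS](bigD1 j)//= leq_add//.
  by move: bj; rewrite /branching; move: (\sum_k _)%N (walks_to _ _ _) => a b; nia.
by apply: leq_sum => i _; rewrite leq_pmulr// markov_outdegree_gt0.
Qed.

(** A letter that is not unary leads to a branching letter in some fixed number
    of steps, so it occurs at level [n] no more often than branching occurs at
    a slightly later level; and branching is rare because the ratio of
    consecutive levels tends to 1. *)
Lemma nonunary_small (e : R) : 0 < e -> exists n0, forall n, (n0 <= n)%N ->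
  (\sum_(i | ~~ unary i) walks_to E n i)%N%:R <= e * t n.+1.
Proof.
move=> e0; pose g := e / d.+1%:R; have g0 : 0 < g by rewrite divr_gt0.
have one i : ~~ unary i -> exists n0, forall n, (n0 <= n)%N ->
    (walks_to E n i)%:R <= g * t n.+1.
  move=> /asboolPn/existsNP[s]/existsNP[j]/not_implyP[wij] /negP/negPn bj.
  have c0 : 0 < Num.min (g / 2) 1.
    by rewrite lt_min ltr01 andbT; lra.
  have [n1 H1] := unexpandable_step unexpT s c0.
  have [n2 H2] := unexpandable_step unexpT 1 c0.
  exists (n1 + n2)%N => n nn.
  have := H1 n.+1 ltac:(lia); have := H2 (n + s).+1 ltac:(lia).
  have c1 : Num.min (g / 2) 1 <= 1 by rewrite ge_min lexx orbT.
  have c2 : Num.min (g / 2) 1 <= g / 2 by rewrite ge_min lexx.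
  move: (Num.min _ _) c0 c1 c2 => c c0 c1 c2; rewrite addSn addn1.
  have : (walks_to E n i <= walks_to E (n + s) j)%N.
    apply: leq_trans (walks_toM_le _ _ _ i _).
    by rewrite leq_pmulr.
  have := branching_small (n + s) bj.
  rewrite -!(ler_nat R) natrD.
  have x0 : 0 <= t n.+1 by [].
  move: (walks_to _ n i)%:R (walks_to _ _ j)%:R (t n.+1) x0 (t (n + s).+1) (t (n + s).+2).
  move=> w w' x x0 y z h1 h2; rewrite !ler_norml => /andP[_ h3] /andP[_ h4].
  have y2 : y <= 2 * x by nra.
  have : c * y <= c * (2 * x) by rewrite ler_wpM2l// ltW.
  have : c * x <= g / 2 * x by rewrite ler_wpM2r.
  lra.
have [n0 Hn0] : exists n0, forall n, (n0 <= n)%N -> forall i, ~~ unary i ->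
    (walks_to E n i)%:R <= g * t n.+1.
  have /choice[N HN] : forall i, exists n0, forall n, (n0 <= n)%N -> ~~ unary i ->
      (walks_to E n i)%:R <= g * t n.+1.
    move=> i; case: (boolP (unary i)) => ui; first by exists 0%N.
    by have [n0 H] := one i ui; exists n0 => n nn _; exact: H.
  exists (\sum_i N i)%N => n nn i; apply: HN; apply: leq_trans nn.
  by rewrite (bigD1 i)//= leq_addr.
exists n0 => n /Hn0 H; rewrite natr_sum.
apply: (@le_trans _ _ (\sum_(i : 'I_d) g * t n.+1)).
  rewrite [leRHS](bigID unary)/= ler_wpDl//; last by apply: ler_sum => i; exact: H.
  by apply: sumr_ge0 => i _; rewrite mulr_ge0// ltW.
rewrite sumr_const card_ord -mulrnAl ler_wpM2r// -mulr_natr /g mulrAC.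
by rewrite ler_pdivrMr// ler_wpM2l ?(ltW e0)// ler_nat.
Qed.

Lemma count_words_below (p : pred (seq 'I_d)) n :
  count p (words_below T n) = (\sum_(i < n) count p (level_words T i))%N.
Proof.
elim: n => [|n IH]; first by rewrite big_ord0.
by rewrite words_belowS count_cat IH big_ord_recr.
Qed.

Lemma count_unary (e : R) : 0 < e -> exists C, forall n,
  (1 - e) * (size (words_below T n))%:R - C <=
  (count (last_in unary) (words_below T n))%:R.
Proof.
move=> e0.
pose s n : R := (count (last_in unary) (level_words T n))%:R.
have [|C HC] := @weighted_cesaro R s (fun n => t n) 1 (fun=> ler0n _ _) _ e e0.
  move=> e' /nonunary_small[n1 Hn1]; exists n1.+1 => -[//|n] nn.
  have := Hn1 n nn; rewrite mul1r /s count_last_in.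
  rewrite card_markov_level => ba; rewrite [X in _ - X%:R](bigID unary)/= natrD.
  by rewrite opprD addrA subrr sub0r normrN ger0_norm.
exists C => n; have := HC n.
rewrite /s -!natr_sum -count_words_below -size_words_below mul1r.
by rewrite ler_norml => /andP[+ _]; lra.
Qed.

Variables (m : nat) (X : set (nat -> 'I_m)).
Hypotheses (X_inv : @shift_map 'I_m @` X `<=` X) (X_her : hereditary X).

(** Each vertex that carries the first unary letter of its word starts a ray,
    these rays are disjoint, and each may be labelled by any window of [X] at
    the same depth while every other vertex is labelled 0. *)
Lemma traces_unary_branches (h : R) (zero : 'I_m) (n : nat) : 0 <= h ->
  val zero = 0%N -> X !=set0 ->
  (forall a k, h * k%:R <= ln (traces X (iota a k))%:R) ->
  h * (count (last_in unary) (words_below T n))%:R <=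
  ln (traces (tree_shift X T) (words_below T n))%:R.
Proof.
move=> h0 zero0 X0 hlow.
have [i0 _] := leaflessT (isT : T [::]).
have /choice[nx Hnx] := markov_succ.
pose f (v : seq 'I_d) := if v is x :: s then nx (last x s) else i0.
have Tgrow v : T v -> T (grow f v).
  move=> Tv; apply/markov_rcons; split => //.
  by case: v Tv => [|x s] _; [left|right; exact: Hnx].
have Titer s v : T v -> T (iter s (grow f) v) by move=> Tv; elim: s => //= s; exact: Tgrow.
pose heads := [seq b <- words_below T n | last_in unary b & entry unary b == b].
pose F b := [seq iter s (grow f) b | s <- iota 0 (n - size b)].
pose G (b : seq 'I_d) := iota (size b) (n - size b).
have last_has b : last_in unary b -> has unary b.
  case: b => // x s us; apply/hasP; exists (last x s) => //; exact: mem_last.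
have below_n b : b \in heads -> (size b < n)%N.
  by rewrite mem_filter mem_words_below => /and3P[].
have prod_le : (\prod_(b <- heads) traces X (G b) <=
    traces (tree_shift X T) (words_below T n))%N.
  apply: leq_trans (traces_prod_le (Y := tree_shift X T) (Z := fun=> X) (F := F) _ _ _) _.
  - by rewrite filter_uniq// words_below_uniq.
  - by [].
  - move=> z Xz; exists (fun v => if has unary v then z (entry unary v) (size v) else zero).
      exact: entry_labelling.
    move=> b; rewrite mem_filter => /andP[/andP[lb /eqP eb] _].
    rewrite /G -[X in iota X _](addn0 (size b)) iotaDl -!map_comp.
    apply: eq_map => s /=.
    rewrite size_iter_grow; have [w /= ->] := iter_grow_cat f b (leq0n s).
    by rewrite has_cat last_has//= entry_cat ?last_has// eb.
  - apply: traces_sub => v /flatten_mapP[b bh /mapP[s]].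
    rewrite mem_iota /= add0n => sn ->; rewrite mem_words_below size_iter_grow.
    move: bh; rewrite mem_filter mem_words_below => /andP[_ /andP[bn /asboolP Tb]].
    by apply/andP; split; [lia|apply/asboolP/Titer].
have count_le : (count (last_in unary) (words_below T n) <= \sum_(b <- heads) (n - size b))%N.
  have -> : (\sum_(b <- heads) (n - size b))%N = size (flatten [seq F b | b <- heads]).
    rewrite size_flatten sumnE !big_map; apply: eq_bigr => b _.
    by rewrite size_map size_iota.
  rewrite -size_filter; apply: uniq_leq_size.
    by rewrite filter_uniq// words_below_uniq.
  (* below its first unary letter, a word has no choice *)
  have forced b w : last_in unary b -> T (b ++ w) ->
      b ++ w = iter (size w) (grow f) b /\ last_in unary (b ++ w).
    move=> lb; elim/last_ind: w => [|w i IH]; first by rewrite cats0.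
    rewrite -rcons_cat => Tw; have [Tw' Mi] := (markov_rcons _ _ _).1 Tw.
    have [bw lw] := IH Tw'.
    case: Mi => [bw0|]; first by rewrite bw0 in lw.
    have fw : last_in (fun k => M k (f (b ++ w))) (b ++ w).
      by case: (b ++ w) lw => //= x s _; exact: Hnx.
    rewrite size_rcons iterS -bw last_in_rcons /grow.
    case: (b ++ w) lw fw => //= x s us Mf Mi; split; last exact: unary_succ us Mi.
    by rewrite (unary_inj us Mi Mf).
  move=> v; rewrite mem_filter mem_words_below => /andP[/last_has hv /andP[vn /asboolP Tv]].
  have vE : v = entry unary v ++ drop (find unary v).+1 v by rewrite cat_take_drop.
  have Te : T (entry unary v).
    by apply: ((markov_is_tree M).2 _ (drop (find unary v).+1 v)); rewrite -vE.
  have size_e : size (entry unary v) = (find unary v).+1.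
    by rewrite /entry size_takel// -has_find.
  have le : last_in unary (entry unary v).
    have := hv; rewrite has_find => fv.
    have := nth_find i0 hv; rewrite -(nth_take i0 (ltnSn _)) -/(entry unary v).
    case: (entry unary v) size_e => //= x s [<-].
    by rewrite -[X in nth _ _ X]/((size (x :: s)).-1) nth_last.
  apply/flatten_mapP; exists (entry unary v).
    rewrite mem_filter le mem_words_below/= -(entry_cat (drop (find unary v).+1 v) (last_has _ le)) -vE eqxx/=.
    by apply/andP; split; [move: hv; rewrite has_find size_e; lia|apply/asboolP].
  have Tv' : T (entry unary v ++ drop (find unary v).+1 v) by rewrite -vE.
  have [eqv _] := forced _ _ le Tv'.
  apply/mapP; exists (size (drop (find unary v).+1 v)); last by rewrite -eqv.
  by rewrite mem_iota/= add0n size_e size_drop; move: hv; rewrite has_find; lia.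
apply: (@le_trans _ _ (h * (\sum_(b <- heads) (n - size b))%N%:R)).
  by rewrite ler_wpM2l// ler_nat.
apply: le_trans (ln_nat_le R _ prod_le); last first.
  by apply: prodn_gt0 => b; exact: traces_gt0.
rewrite ln_nat_prod; last by move=> b; exact: traces_gt0.
rewrite natr_sum mulr_sumr; apply: ler_sum => b _.
exact: hlow.
Qed.

(** Almost all vertices lie on the disjoint unary rays, which may be
    labelled independently. *)
Lemma tree_entropy_ge (zero : 'I_m) : val zero = 0%N ->
  (shift_entropy R X <= tree_entropy R X T)%E.
Proof.
move=> zero0; have [X0|X0] := pselect (X !=set0); last first.
  have -> : X = set0 by apply/seteqP; split => // x Xx; case: X0; exists x.
  rewrite shift_entropy0; apply: (@limn_esup_ge_near _ _ _ 0%N) => n _.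
  by rewrite lee_fin divr_ge0// ln_nat_ge0.
have [h [h0 -> hlow _]] := shift_entropy_bounds R X_inv X0.
apply/lee_addgt0Pr => e e0; have e2 : 0 < e / 2 by lra.
(* the proportion of vertices off the unary rays, each of which loses h *)
have c0 : 0 < e / 2 / (h + 1) by rewrite divr_gt0//; lra.
have [C HC] := count_unary c0.
have [n0 Hn0] := words_below_unbounded unexpT (Num.max 1 (`|h * C| / (e / 2))).
rewrite addeC -leeBlDl//.
apply: (@limn_esup_ge_near _ _ _ n0) => n nn.
have := Hn0 n.+1 (leqW nn); rewrite ge_max => /andP[b1].
rewrite ler_pdivrMr// => bC.
rewrite card_patterns card_ball -EFinB lee_fin ler_pdivlMr; last by rewrite (lt_le_trans _ b1).
apply: le_trans (traces_unary_branches n.+1 h0 zero0 X0 hlow).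
apply: le_trans (ler_wpM2l h0 (HC n.+1)).
have hc : h * (e / 2 / (h + 1)) <= e / 2.
  have -> : h * (e / 2 / (h + 1)) = e / 2 * (h / (h + 1)).
    by field; rewrite gt_eqF//; lra.
  by rewrite ler_piMr ?(ltW e2)// ler_pdivrMr; lra.
move: (ler_norm (h * C)) bC; move: (size _)%:R b1 => b b1 hC bC.
have := ler_wpM2r (le_trans ler01 b1) hc; lra.
Qed.

End LeaflessMarkov.

(** * Independence sets of positive density carry entropy *)

(** Two letters that may be chosen freely at the vertices of [S] give at least
    [2 ^ n] patterns over [n] of these vertices. *)
Lemma dense_independent_entropy (R : realType) (A : finType) (d : nat)
    (X : set (nat -> A)) (T : set (seq 'I_d)) (B : set A) (a b : A) :
  a <> b -> B a -> B b -> has_dense_independent_set R B X T ->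
  (0 < tree_entropy R X T)%E.
Proof.
move=> ab Ba Bb [S [ST indS [delta d0 dS]]].
have two_le n : (2 ^ size (words_below S n) <=
    traces (tree_shift X T) (words_below T n))%N.
  pose Z : set (unit -> A) := [set (fun=> a); (fun=> b)].
  have Z2 : (2 <= traces Z [:: tt])%N.
    rewrite /traces -[2%N]/(size [:: [:: a]; [:: b]]); apply: uniq_leq_size.
      by rewrite /= andbT inE; apply/eqP => -[].
    move=> w; rewrite !inE => /orP[|] /eqP ->; apply/trace_wordsP.
      by exists (fun=> a) => //; left.
    by exists (fun=> b) => //; right.
  apply: (@leq_trans (\prod_(g <- words_below S n) traces Z [:: tt])%N).
    rewrite big_const_seq count_predT iter_muln_1.
    by case: (size _) => // k; rewrite leq_exp2r.
  apply: leq_trans (traces_prod_le (Y := tree_shift X T) (Z := fun=> Z)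
    (F := fun g => [:: g]) (words_below_uniq S n) _ _) _.
  - by move=> g; exists (fun=> a); left.
  - move=> z Zz; have [|t Xt tE] := indS (fun g => z g tt).
      by move=> g _; case: (Zz g) => ->.
    exists t => // g; rewrite mem_words_below => /andP[_ /asboolP Sg] /=.
    by rewrite tE.
  apply: traces_sub => v /flatten_mapP[g gS]; rewrite inE => /eqP ->.
  move: gS; rewrite !mem_words_below => /andP[-> /asboolP Sg].
  by apply/asboolP/ST.
have ln2 : 0 < ln 2 :> R by rewrite ln_gt0// ltr1n.
have hd : 0 < delta / 2 by lra.
have [n0 Hn0] := (cvgnP _ _).1 dS _ hd.
apply: (@lt_le_trans _ _ (delta / 2 * ln 2)%:E); first by rewrite lte_fin mulr_gt0.
apply: (@limn_esup_ge_near _ _ _ n0) => n /Hn0.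
rewrite card_ballI// card_patterns card_ball ler_norml => /andP[dn _].
rewrite lee_fin.
apply: (@le_trans _ _ ((size (words_below S n.+1))%:R / (size (words_below T n.+1))%:R * ln 2)).
  by rewrite ler_wpM2r ?(ltW ln2)//; lra.
rewrite mulrAC ler_wpM2r ?invr_ge0// -ln_natX//.
by apply: ln_nat_le; [rewrite expn_gt0|exact: two_le].
Qed.

(** * Points with a positive frequency of nonzero symbols *)

Section Frequency.
Variables (R : realType) (m : nat) (X : set (nat -> 'I_m)).
Hypotheses (X_shift : is_shift X) (X0 : X !=set0).

Definition nonzeros (x : nat -> 'I_m) (n : nat) : nat := count (fun i => 0 < x i)%N (iota 0 n).

Lemma nonzeros_le x n : (nonzeros x n <= n)%N.
Proof. by rewrite -[leqRHS](size_iota 0 n) count_size. Qed.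

Lemma nonzerosD x n k :
  nonzeros x (n + k) = (nonzeros x n + nonzeros (fun j => x (n + j)%N) k)%N.
Proof.
rewrite /nonzeros iotaD count_cat; congr addn.
by rewrite add0n -[X in iota X _](addn0 n) iotaDl count_map.
Qed.

Lemma max_nonzeros_exists : exists mx : nat -> nat, forall n,
  (exists2 x, X x & nonzeros x n = mx n) /\ (forall x, X x -> (nonzeros x n <= mx n)%N).
Proof.
suff /choice[mx Hmx] : forall n, exists k, (exists2 x, X x & nonzeros x n = k) /\
    (forall x, X x -> (nonzeros x n <= k)%N) by exists mx.
move=> n; pose P k := `[< exists2 x, X x & nonzeros x n = k >].
have exP : exists k, P k.
  by have [x Xx] := X0; exists (nonzeros x n); apply/asboolP; exists x.
have ubP k : P k -> (k <= n)%N by move=> /asboolP[x _ <-]; exact: nonzeros_le.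
have [k /asboolP Pk kmax] := ex_maxnP exP ubP; exists k; split => // x Xx.
by apply: kmax; apply/asboolP; exists x.
Qed.

(** Compactness, in the form of a point all of whose prefixes are prefixes of
    infinitely many members of the sequence. *)
Lemma shift_cluster (y : nat -> nat -> 'I_m) : (forall n, X (y n)) ->
  exists2 x, X x & forall k n0, exists n, (n0 <= n)%N /\ forall i, (i < k)%N -> y n i = x i.
Proof.
move=> Xy; have [Xclosed _] := X_shift.
pose FS := prod_topology (fun _ : nat => discrete_topology 'I_m).
have fin : finite_set [set: discrete_topology 'I_m] := @finite_finset 'I_m setT.
have cT : compact [set: FS].
  have := @tychonoff nat (fun _ => discrete_topology 'I_m) (fun _ => setT)
    (fun _ => finite_compact fin).
  by congr compact; apply/seteqP; split.
have cX : compact (X : set FS) by apply: (subclosed_compact Xclosed cT).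
have Fy : ((y : nat -> FS) @ \oo) X by exists 0%N => // n _; exact: Xy.
have [x [Xx clx]] := cX _ _ Fy.
exists x => // k n0.
have nbx : nbhs (x : FS) [set z : FS | forall i, (i < k)%N -> z i = x i].
  elim: k => [|k IH]; first by apply: filterS filterT => z _ i.
  have xk : nbhs (x : FS) [set z : FS | z k = x k].
    exact: (@proj_continuous nat (fun _ => discrete_topology 'I_m) k x _
      (@discrete_set1 (discrete_topology 'I_m) (x k))).
  apply: filterS (filterI IH xk) => z [zi zk] i.
  by rewrite ltnS leq_eqVlt => /orP[/eqP ->|/zi].
have near_n : ((y : nat -> FS) @ \oo) [set y n | n in [set n | (n0 <= n)%N]].
  by exists n0 => // n nn; exists n.
have [_ [[n nn <-] yx]] := clx _ _ near_n nbx.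
by exists n.
Qed.

Lemma all_words_weight (z : R) (n : nat) : exists s : seq (seq 'I_m),
  [/\ uniq s, forall w, (w \in s) = (size w == n) &
  \sum_(w <- s) z ^+ count (fun a : 'I_m => 0 < a)%N w =
    (\sum_(a : 'I_m) z ^+ (0 < a)%N) ^+ n].
Proof.
elim: n => [|n [s [us ms ws]]].
  exists [:: [::]]; split => //; last by rewrite big_seq1.
  by move=> w; rewrite inE; case: w.
exists [seq a :: w | a <- enum 'I_m, w <- s]; split.
- apply: allpairs_uniq => //; first exact: enum_uniq.
  by move=> [a w] [b v] _ _ /= [-> ->].
- move=> w; apply/allpairsP/idP => [[[a v] /= [_ + ->]]|]; first by rewrite ms.
  by case: w => // a w sw; exists (a, w); rewrite mem_enum ms.
rewrite big_allpairs_dep exprS -ws big_distrl/= big_enum/=; apply: eq_bigr => a _.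
by rewrite big_distrr/=; apply: eq_bigr => w _; rewrite exprD.
Qed.

(** Chernoff-type bound: weighting a word by [z] to the number of its nonzero
    letters makes the sum over all words a power. *)
Lemma traces_nonzeros_le (z : R) (n M : nat) : 0 < z <= 1 ->
  (forall x, X x -> (nonzeros x n <= M)%N) ->
  (traces X (iota 0 n))%:R * z ^+ M <= (1 + m%:R * z) ^+ n.
Proof.
move=> /andP[z0 z1] HM; have [s [us ms ws]] := all_words_weight z n.
have c_le : \sum_(a : 'I_m) z ^+ (0 < a)%N <= 1 + m%:R * z.
  case: (posnP m) => [m0|m0].
    by rewrite big1 ?addr_ge0 ?mulr_ge0// ?ltW// => -[a am]; move: (am); rewrite m0.
  rewrite (bigD1 (Ordinal m0))//= expr0 lerD2l.
  apply: (@le_trans _ _ (\sum_(a : 'I_m | a != Ordinal m0) z)).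
    apply: ler_sum => a a0; rewrite lt0n (_ : (val a != 0)%N) ?expr1//.
  rewrite sumr_const -[leLHS]mulr_natl ler_wpM2r ?(ltW z0)// ler_nat.
  by rewrite (leq_trans (max_card _))// card_ord.
apply: (@le_trans _ _ ((\sum_(a : 'I_m) z ^+ (0 < a)%N) ^+ n)); last first.
  have w0 : 0 <= \sum_(a : 'I_m) z ^+ (0 < a)%N.
    by apply: sumr_ge0 => a _; rewrite exprn_ge0// ltW.
  by apply: lerXn2r; rewrite ?nnegrE// addr_ge0// mulr_ge0// ltW.
rewrite -ws (bigID (mem (trace_words X (iota 0 n))))/=.
apply: ler_wpDr; first by apply: sumr_ge0 => w _; rewrite exprn_ge0// ltW.
rewrite -big_filter (perm_big (trace_words X (iota 0 n))); last first.
  apply: uniq_perm; rewrite ?filter_uniq// ?trace_words_uniq// => w.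
  rewrite mem_filter ms /=; case: (boolP (w \in _)) => //= /size_trace_word ->.
  by rewrite size_iota eqxx.
rewrite /traces -sum1_size natr_sum mulr_suml [leLHS]big_seq [leRHS]big_seq.
apply: ler_sum => w /trace_wordsP[x Xx <-]; rewrite mul1r count_map.
apply: ler_wiXn2l; rewrite ?(ltW z0)//; exact: HM.
Qed.

Variable h : R.
Hypotheses (h0 : 0 < h) (hlow : forall n, h * n%:R <= ln (traces X (iota 0 n))%:R).

(** Words with few nonzero letters are few: if [delta] were 0, the previous
    bound would force [h <= (m + 1) z] for every small [z]. *)
Lemma entropy_nonzeros (mx : nat -> nat) (delta : R) :
  (forall n x, X x -> (nonzeros x n <= mx n)%N) ->
  (forall e, 0 < e -> exists C, forall n, (mx n)%:R <= (delta + e) * n%:R + C) ->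
  0 <= delta -> 0 < delta.
Proof.
move=> Hmx up d0; rewrite lt_neqAle d0 andbT; apply/eqP => dE.
pose z : R := Num.min 2^-1 (h / 2 / (m%:R + 1)).
have m1 : 0 < m%:R + 1 :> R by rewrite ltr_wpDl.
have z0 : 0 < z by rewrite lt_min invr_gt0 ltr0n !divr_gt0.
have z1 : z <= 2^-1 by rewrite ge_min lexx.
have z2 : m%:R * z + z <= h / 2.
  rewrite -[X in _ + X]mul1r -mulrDl mulrC -ler_pdivlMr//.
  by rewrite /z ge_min lexx orbT.
have z3 : z < 1 by apply: le_lt_trans z1 _; rewrite invf_lt1// ltr1n.
have lz : 0 < - ln z by rewrite oppr_gt0 ln_lt0// z0 z3.
have e0 : 0 < z / - ln z by rewrite divr_gt0.
(* with this slope, weighting by - ln z costs z per letter *)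
have [C HC] := up _ e0.
have : ~ h <= 0 by apply/negP; rewrite -ltNge.
apply; suff : h - (h / 2) <= 0 by lra.
apply: (@nat_mul_bounded _ _ (C * - ln z)) => n.
move: z z0 z2 z3 lz e0 HC {z1} => z z0 z2 z3 lz e0 HC.
have zz : 0 < z <= 1 by rewrite z0 ltW.
have := traces_nonzeros_le zz (Hmx n).
have t0 : 0 < (traces X (iota 0 n))%:R :> R by rewrite ltr0n traces_gt0.
have b0 : 0 < 1 + m%:R * z by rewrite ltr_wpDr ?mulr_ge0// ltW.
rewrite -ler_ln ?posrE ?mulr_gt0 ?exprn_gt0//.
rewrite lnM ?posrE ?exprn_gt0// !lnXn// -(mulr_natl (ln z)) -(mulr_natl (ln (1 + _))).
have := hlow n; have := HC n; rewrite -dE add0r.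
have l1 : ln (1 + m%:R * z) <= m%:R * z.
  by rewrite le_ln1Dx// (lt_le_trans (ltrN10 _))// mulr_ge0// ltW.
have n0 : 0 <= n%:R :> R by [].
have l2 := ler_wpM2l n0 l1.
have l3 := ler_wpM2l n0 z2.
move: (ln (traces _ _)%:R) ((mx n)%:R) => L q h1 h2 h3.
have := ler_wpM2r (ltW lz) h1.
have -> : (z / - ln z * n%:R + C) * - ln z = z * n%:R + C * - ln z.
  by field; rewrite lt_eqF// -oppr_gt0.
lra.
Qed.

(** If every point of the shift had a sparse prefix, cutting off such prefixes
    again and again would make all long words sparse. *)
Lemma dense_prefixes (mx : nat -> nat) (delta e : R) (L : nat) :
  (forall n, exists2 x, X x & nonzeros x n = mx n) ->
  (forall n, delta * n%:R <= (mx n)%:R) ->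
  0 < e -> e <= delta ->
  exists2 x, X x & forall k, (k <= L)%N -> (delta - e) * k%:R <= (nonzeros x k)%:R.
Proof.
move=> mxP low e0 ed; apply: contrapT => no.
have sparse x : X x -> exists k, [/\ (0 < k)%N, (k <= L)%N &
    (nonzeros x k)%:R < (delta - e) * k%:R].
  move=> Xx; apply: contrapT => nk; apply: no; exists x => // k kL.
  rewrite leNgt; apply/negP => xk; apply: nk; exists k; split => //.
  by rewrite lt0n; apply: contraTneq xk => ->; rewrite mulr0 -leNgt ler0n.
have bound n x : X x -> (nonzeros x n)%:R <= (delta - e) * n%:R + L%:R.
  have [N] := ubnP n; elim: N n x => // N IH n x nN Xx.
  have de : 0 <= (delta - e) * n%:R by rewrite mulr_ge0// subr_ge0.
  case: (leqP n L) => nL.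
    by rewrite ler_wpDl// ler_nat (leq_trans (nonzeros_le _ _)).
  have [k [k0 kL xk]] := sparse x Xx.
  have kn : (k <= n)%N by lia.
  have := IH (n - k)%N (fun j => x (k + j)%N) ltac:(lia) (shift_iter X_shift.2 k Xx).
  move: (n - k)%N (subnKC kn) => p <-; rewrite nonzerosD !natrD.
  by move: xk; move: (nonzeros _ _)%:R (nonzeros _ _)%:R => a b; lra.
have [n Hn] := nat_unbounded ((L%:R + 1) / e).
have := Hn n (leqnn n); rewrite ler_pdivrMr// => ne.
have [x Xx xE] := mxP n; have := bound n x Xx; rewrite xE.
by have := low n; lra.
Qed.

(** The maximal numbers of nonzero letters are subadditive, which bounds the
    prefixes of every point from above with the optimal slope [delta]. A limit
    of points with dense prefixes attains this slope from below, so that the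
    frequency exists. *)
Lemma nonzero_frequency : exists x delta, [/\ X x, 0 < delta &
  forall e : R, 0 < e -> exists C, forall n,
    `|(nonzeros x n)%:R - delta * n%:R| <= e * n%:R + C].
Proof.
have [mx Hmx] := max_nonzeros_exists.
have mxub n x : X x -> (nonzeros x n <= mx n)%N by exact: (Hmx n).2.
have mxex n : exists2 x, X x & nonzeros x n = mx n by exact: (Hmx n).1.
pose u n : R := (mx n)%:R.
have [|n k|delta [d0 low up]] := @fekete R u; first by move=> n; exact: ler0n.
  rewrite /u -natrD ler_nat; have [x Xx <-] := mxex (n + k)%N.
  by rewrite nonzerosD leq_add ?mxub//; exact: (shift_iter X_shift.2 n Xx).
have delta0 := entropy_nonzeros mxub up d0.
have /choice[y Hy] : forall n, exists x, X x /\ forall k, (k <= n)%N ->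
    (delta - delta / n.+1%:R) * k%:R <= (nonzeros x k)%:R.
  move=> n; have [||x Xx Hx] := @dense_prefixes mx delta (delta / n.+1%:R) n mxex low.
  - by rewrite divr_gt0.
  - by rewrite ler_pdivrMr// ler_peMr// ler1n.
  by exists x.
have [x Xx Hx] := shift_cluster (fun n => (Hy n).1).
exists x, delta; split => // e e0; have [C HC] := up e e0; exists C => n.
have xlow : delta * n%:R <= (nonzeros x n)%:R.
  rewrite -subr_le0; apply: (@nat_mul_bounded _ _ (delta * n%:R)) => t.
  have [N [tN yx]] := Hx n (n + t)%N.
  have := (Hy N).2 n ltac:(lia).
  rewrite (_ : nonzeros (y N) n = nonzeros x n); last first.
    by apply: eq_in_count => i; rewrite mem_iota /= => ni; rewrite yx.
  rewrite mulrBl lerBlDr -lerBlDl mulrAC ler_pdivlMr// mulrC.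
  have tN' : t%:R <= N.+1%:R :> R by rewrite ler_nat; lia.
  move=> h1; have [neg|pos] := lerP (delta * n%:R - (nonzeros x n)%:R) 0.
    by apply: (@le_trans _ _ 0); rewrite ?mulr_ge0_le0// mulr_ge0.
  by apply: le_trans h1; rewrite ler_wpM2r// ltW.
have := HC n; have : (nonzeros x n)%:R <= u n by rewrite ler_nat mxub.
by move=> h1 h2; rewrite ger0_norm; lra.
Qed.

End Frequency.

(** * Sets of positive density *)

Section Density.
Variables (R : realType) (d : nat) (T : set (seq 'I_d)).
Hypothesis unexpT : unexpandable R T.
Local Notation b n := (size (words_below T n)).

Lemma density_intro (S : set (seq 'I_d)) (delta : R) : S `<=` T ->
  (forall e : R, 0 < e -> exists C n0, forall n, (n0 <= n)%N ->
    `|(size (words_below S n))%:R - delta * (b n)%:R| <= e * (b n)%:R + C) ->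
  has_density T S delta.
Proof.
move=> ST err; rewrite /has_density.
rewrite (_ : (fun n => _) = fun n =>
    (size (words_below S n.+1))%:R / (b n.+1)%:R); last first.
  by apply/funext => n; rewrite card_ballI// card_ball.
apply: linear_error_cvg => [C|e /err[C [n0 H]]].
  have [n0 H] := words_below_unbounded unexpT C.
  by exists n0 => n nn; apply: H; lia.
by exists C, n0 => n nn; apply: H; lia.
Qed.

(** A set that takes a fixed proportion of every late level contains a set
    whose density exists: on each level, keep as many words as are needed to
    follow the quotients by [D] of the sizes of the balls. *)
Lemma dense_subset (S : set (seq 'I_d)) (D n0 : nat) : S `<=` T ->
  (forall n, (n0 <= n)%N -> (#|level T n| <= D * #|level S n|)%N) ->
  exists2 S' : set (seq 'I_d), S' `<=` S & exists2 delta : R,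
    0 < delta & has_density T S' delta.
Proof.
move=> ST HD.
have D0 : (0 < D)%N.
  have [n1 H1] := unexpandable_level_gt0 unexpT.
  rewrite lt0n; apply/eqP => D0.
  have := HD (n0 + n1)%N (leq_addr _ _); have := H1 (n0 + n1)%N (leq_addl _ _).
  by rewrite D0 mul0n; case: #|_|.
pose s n := (b n.+1 %/ D - b n %/ D)%N.
pose S' : set (seq 'I_d) := [set v | (n0 <= size v)%N &&
  (v \in take (s (size v)) (level_words S (size v)))].
have levelS' n : #|level S' n| = if (n0 <= n)%N then s n else 0%N.
  rewrite -size_level_words; case: ifP => nn; last first.
    apply/eqP; rewrite size_eq0; case E: (level_words S' n) => [//|v l].
    have : v \in level_words S' n by rewrite E mem_head.
    rewrite mem_level_words => /andP[/eqP sv] /asboolP /andP[+ _].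
    by rewrite sv nn.
  rewrite -[RHS](@size_takel (s n) _ (level_words S n)); last first.
    rewrite size_level_words /s words_belowS size_cat size_level_words leq_subLR.
    apply: leq_trans (leq_div2r D (leq_add (leqnn (b n)) (HD n nn))) _.
    by rewrite mulnC addnC divnMDl// addnC.
  apply: perm_size; apply: uniq_perm.
  - exact: level_words_uniq.
  - by rewrite take_uniq// level_words_uniq.
  move=> v; rewrite mem_level_words; apply/andP/idP => [[/eqP <-] /asboolP /andP[]//|vs].
  have /[!mem_level_words]/andP[/eqP sv _] := mem_take vs.
  by rewrite sv eqxx; split => //; apply/asboolP; rewrite /S'/= sv nn.
exists S' => [v /andP[_ /mem_take]|].
  by rewrite mem_level_words => /andP[_ /asboolP].
exists D%:R^-1; first by rewrite invr_gt0 ltr0n.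
apply: density_intro => [v /andP[_ /mem_take]|e e0].
  by rewrite mem_level_words => /andP[_ /asboolP /ST].
have below n : size (words_below S' n) = (b n %/ D - b (minn n n0) %/ D)%N.
  elim: n => [|n IH]; first by rewrite min0n subnn.
  have mono : (b n %/ D <= b n.+1 %/ D)%N.
    by apply: leq_div2r; rewrite words_belowS size_cat leq_addr.
  rewrite words_belowS size_cat size_level_words IH levelS' /s.
  case: ifPn => nn; last first.
    by rewrite -ltnNge in nn; rewrite (minn_idPl nn) (minn_idPl (ltnW nn)) !subnn.
  rewrite (minn_idPr nn) (minn_idPr (leqW nn)).
  have : (b n0 %/ D <= b n %/ D)%N.
    by apply: leq_div2r; rewrite -(subnKC nn) words_belowD size_cat leq_addr.
  move: mono; move: (b n %/ D)%N (b n.+1 %/ D)%N (b n0 %/ D)%N => x y z; lia.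
exists ((b n0)%:R + 1), n0 => n nn; rewrite below (minn_idPr nn).
have le0 : (b n0 %/ D <= b n %/ D)%N.
  by apply: leq_div2r; rewrite -(subnKC nn) words_belowD size_cat leq_addr.
rewrite natrB//.
have : (b n0 %/ D <= b n0)%N := leq_div _ _.
have := divn_eq (b n) D; have := ltn_pmod (b n) D0.
move: (b n0) (b n0 %/ D)%N (b n %/ D)%N (b n %% D)%N le0 => b0 y x r xy rD bn yb.
have b_ge0 : 0 <= e * (b n)%:R by rewrite mulr_ge0// ltW.
have D0' : 0 < D%:R :> R by rewrite ltr0n.
have -> : D%:R^-1 * (b n)%:R = x%:R + r%:R / D%:R :> R.
  by rewrite bn natrD natrM; field; rewrite gt_eqF.
have r0 : 0 <= r%:R / D%:R :> R by rewrite divr_ge0.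
have r1 : r%:R / D%:R <= 1 :> R by rewrite ler_pdivrMr// mul1r ler_nat ltnW.
have y0 : 0 <= y%:R :> R by [].
have {}yb : y%:R <= b0%:R :> R by rewrite ler_nat.
move: (e * _) (r%:R / _) b_ge0 r0 r1 => u v u0 v0 v1.
by rewrite ler_norml; apply/andP; split; lra.
Qed.

(** Summation by parts against a nondecreasing weight: a frequency for the
    uniform weights is one for these weights as well, with an error measured
    by the last of them. *)
Lemma abel_frequency (q l : nat -> R) (delta e C : R) :
  (forall n, 0 <= l n) -> (forall n, l n <= l n.+1) -> 0 <= e ->
  (forall n, `|\sum_(i < n) q i - delta * n%:R| <= e * n%:R + C) ->
  forall n, `|\sum_(i < n) q i * l i - delta * \sum_(i < n) l i| <=
    (e * n%:R + C) * l n *+ 2.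
Proof.
move=> l0 lS e0 err n.
pose E n := \sum_(i < n) q i - delta * n%:R.
pose S n := \sum_(i < n) q i * l i - delta * \sum_(i < n) l i.
have C0 : 0 <= C by have := err 0%N; rewrite !mulr0 add0r; apply: le_trans.
(* the bound on the summed part telescopes because l is nondecreasing *)
have parts : `|S n - E n * l n| <= (e * n%:R + C) * (l n - l 0%N).
  elim: n => [|n IH].
    by rewrite /S /E !big_ord0 !mulr0 !subrr mul0r subrr normr0 mulr0.
  have -> : S n.+1 - E n.+1 * l n.+1 =
      (S n - E n * l n) - E n.+1 * (l n.+1 - l n).
    by rewrite /S /E !big_ord_recr/= -natr1; ring.
  apply: (le_trans (ler_normB _ _)); rewrite normrM.
  rewrite [`|l n.+1 - l n|]ger0_norm ?subr_ge0//.
  have := ler_wpM2r (_ : 0 <= l n.+1 - l n) (err n.+1); rewrite subr_ge0 => /(_ (lS n)).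
  have mono : l 0%N <= l n by elim: (n) => // k; move/le_trans; apply.
  have : e * n%:R * (l n - l 0%N) <= e * n.+1%:R * (l n - l 0%N).
    by rewrite ler_wpM2r ?subr_ge0// ler_wpM2l// ler_nat.
  rewrite -/(E n.+1); move: (`|E n.+1|) (`|S n - _|) IH => u v IH h1 h2.
  rewrite -[n.+1%:R]natr1 in h1 h2 *; lra.
rewrite -/(S n) -[S n](subrK (E n * l n)).
apply: (le_trans (ler_normD _ _)); rewrite normrM (ger0_norm (l0 n)).
have := ler_wpM2r (l0 n) (err n); rewrite -/(E n).
have : 0 <= (e * n%:R + C) * l 0%N by rewrite mulr_ge0// addr_ge0// mulr_ge0.
by rewrite mulr2n; lra.
Qed.

End Density.

(** * Growth of the letters of an unexpandable Markov-Cayley tree *)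

Lemma poly_growth_cumul (f : nat -> nat) (k : nat) : poly_growth f k ->
  exists D n0, forall n, (n0 <= n)%N -> (n * f n <= D * (\sum_(i < n) f i).+1)%N.
Proof.
move=> [C [n0 fk]]; have [A HA] := expn_add_le 1 k.
pose n1 := n0.+1; pose D := (n1 ^ k.+1 + A * C)%N.
have pow_le n : (n1 <= n)%N -> (n ^ k.+1 <= D * (\sum_(i < n) f i).+1)%N.
  elim: n => // n IH; rewrite leq_eqVlt => /orP[/eqP <-|].
    by rewrite (leq_trans (leq_addr (A * C) _))// leq_pmulr.
  rewrite ltnS => nn; have := HA n ltac:(lia); rewrite addn1.
  have [fn _] := fk n ltac:(lia); have := IH nn; rewrite big_ord_recr/=.
  move: (\sum_(i < n) f i)%N fn => s; rewrite /D.
  move: (n ^ k)%N (n ^ k.+1)%N (n.+1 ^ k.+1)%N (n1 ^ k.+1)%N => x y z w.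
  nia.
exists (C * D)%N, n1 => n nn; have [_ fn] := fk n ltac:(lia).
apply: (@leq_trans (C * n ^ k.+1)); first by rewrite expnS mulnCA leq_mul.
by rewrite -mulnA leq_mul// pow_le.
Qed.

Lemma poly_growth_lt (f g : nat -> nat) (k l : nat) : (k < l)%N ->
  poly_growth f k -> poly_growth g l ->
  exists D n0, forall n, (n0 <= n)%N -> (n * f n <= D * g n)%N.
Proof.
move=> kl [C [n0 fk]] [D [n1 gl]]; exists (C * D)%N, (n0 + n1).+1 => n nn.
have [_ fn] := fk n ltac:(lia); have [gn _] := gl n ltac:(lia).
apply: (@leq_trans (C * n ^ k.+1)); first by rewrite expnS mulnCA leq_mul.
rewrite -mulnA leq_mul// (leq_trans _ gn)// leq_pexp2l//; lia.
Qed.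

Section MarkovGrowth.
Variables (R : realType) (d : nat) (M : 'M[bool]_d).
Local Notation T := (markov_tree M).
Local Notation E := (fun i j => M i j).
Local Notation t n := (#|level T n|%:R : R).
Hypothesis unexpT : unexpandable R T.

(** Two closed walks of the same length through [i] would make the number of
    walks to [i], hence the levels, grow exponentially. *)
Lemma unexpandable_closed_walks (i : 'I_d) (n : nat) : (walks E n i i <= 1)%N.
Proof.
rewrite leqNgt; apply/negP => two.
have n_gt0 : (0 < n)%N by case: n two => //=; rewrite eqxx.
have half : (0 : R) < 2^-1 by rewrite invr_gt0.
have [n0 H0] := unexpandable_step unexpT n half.
have w_gt0 k : (0 < walks_to E k i)%N.
  apply: (@walks_to_anti _ _ _ (n * k)); first by rewrite leq_pmull.
  apply: leq_trans (walks_le_walks_to _ _ i _).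
  by apply: leq_trans (walks_closedX _ _ _ _); rewrite expn_gt0 ltnW.
have t_up k : 2 ^+ k * t (n0.+1 + n * k)%N <= 3 ^+ k * t n0.+1.
  elim: k => [|k IH]; first by rewrite muln0 addn0 !expr0.
  have := H0 (n0.+1 + n * k)%N ltac:(lia).
  rewrite -addnA -mulnSr ler_norml => /andP[_ h].
  rewrite !exprS -!mulrA; move: IH h; move: (t _) (t _) => x y.
  have : 0 <= (2 : R) ^+ k by rewrite exprn_ge0.
  move: (2 ^+ k) (3 ^+ k * _) => a b a0 h1 h2.
  have := ler_wpM2l a0 h2; lra.
have w_low k : 2 ^+ k <= t (n0.+1 + n * k)%N.
  rewrite -natrX ler_nat addSn card_markov_level (bigD1 i)//=.
  apply: leq_trans (leq_addr _ _); apply: leq_trans (walks_toM_le _ _ _ i _).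
  rewrite (@leq_trans (walks E (n * k) i i))// ?leq_pmull//.
  by apply: leq_trans (walks_closedX _ _ _ _); case: k => // k; rewrite leq_exp2r.
(* 4 ^ k cannot be bounded by a multiple of 3 ^ k *)
have bernoulli k : 3 ^+ k * (1 + k%:R / 3) <= 2 ^+ k * 2 ^+ k :> R.
  elim: k => [|k IH]; first by rewrite !expr0 mul0r addr0 mulr1.
  rewrite !exprS -[k.+1%:R]natr1; have : 0 <= (3 : R) ^+ k by rewrite exprn_ge0.
  have : 0 <= k%:R :> R by [].
  move: (3 ^+ k) (2 ^+ k) (k%:R) IH => a b c IH c0 a0.
  have := mulr_ge0 a0 c0; lra.
have : (3 : R)^-1 <= 0.
  apply: (@nat_mul_bounded _ _ (t n0.+1)) => k.
  have a0 : 0 < (3 : R) ^+ k by rewrite exprn_gt0.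
  rewrite -(ler_pM2l a0); apply: le_trans (t_up k).
  have b0 : 0 <= (2 : R) ^+ k by rewrite exprn_ge0.
  have := ler_wpM2l b0 (w_low k); have := bernoulli k; lra.
by rewrite leNgt invr_gt0 ltr0n.
Qed.

Definition letter_count (n : nat) (i : 'I_d) : nat :=
  count (last_in (pred1 i)) (level_words T n).

Lemma letter_countS n i : letter_count n.+1 i = walks_to E n i.
Proof. by rewrite /letter_count count_last_in big_pred1_eq. Qed.

Lemma letter_count_has_degree (i : 'I_d) : has_degree (letter_count ^~ i).
Proof.
apply: (has_degree_shift (N := 1)) (walks_to_has_degree unexpandable_closed_walks i).
by move=> n; rewrite addn1 letter_countS.
Qed.

Lemma level_poly_growth : exists k, poly_growth (fun n => #|level T n|) k.
Proof.
have : has_degree (fun n => #|level T n|).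
  apply: (has_degree_shift (N := 1)) (has_degree_sum
    (index_enum 'I_d) (P := xpredT)
    (fun i _ => walks_to_has_degree unexpandable_closed_walks i)).
  by move=> n; rewrite addn1 card_markov_level.
case=> // -[n0 H0]; have [n1 H1] := unexpandable_level_gt0 unexpT.
by have := H1 (n0 + n1)%N (leq_addl _ _); rewrite H0// leq_addr.
Qed.

Definition live_letter (i : 'I_d) : bool :=
  `[< exists2 r : nat -> 'I_d, r 0%N = i & forall j, M (r j) (r j.+1) >].

Lemma markov_live (v : seq 'I_d) : T v -> v <> [::] ->
  live_part T v <-> last_in live_letter v.
Proof.
case: v => // x s Tv _; split => [[r Tr vr]|/asboolP[r r0 rM]].
  apply/asboolP; exists (fun j => r (size s + j)%N) => [|j].
    by move: vr; rewrite [size _]/= mkseqS => /(congr1 (last x)); rewrite last_rcons addn0.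
  have := Tr (size s + j).+2; rewrite !mkseqS => /markov_rcons[_ []].
    by case: (mkseq _ _).
  by rewrite last_in_rcons addnS.
pose f (u : seq 'I_d) := r (size u - size s)%N.
apply: (iter_grow_live (f := f)); first exact: markov_is_tree.
suff H n : T (iter n (grow f) (x :: s)) /\
    last_in (pred1 (r n)) (iter n (grow f) (x :: s)) by move=> n; case: (H n).
elim: n => [|n [IH1 IH2]]; first by split => //=; rewrite r0.
rewrite iterS /grow; split; last first.
  rewrite last_in_rcons /f size_iter_grow /= addSn.
  by rewrite (_ : (_ - _)%N = n.+1) ?eqxx//; lia.
apply/markov_rcons; split => //; right.
rewrite /f size_iter_grow /= addSn (_ : (_ - _)%N = n.+1); last lia.
by move: IH2; case: (iter _ _ _) => //= y l /eqP ->; exact: rM.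
Qed.

Lemma card_level_letters (n : nat) : (0 < n)%N ->
  #|level T n| = (\sum_i letter_count n i)%N.
Proof.
by case: n => // n _; rewrite card_markov_level; apply: eq_bigr => i _; rewrite letter_countS.
Qed.

Lemma card_live_level (n : nat) : (0 < n)%N ->
  #|level (live_part T) n| = (\sum_(i | live_letter i) letter_count n i)%N.
Proof.
case: n => // n _; under eq_bigr do rewrite letter_countS.
rewrite -count_last_in -size_level_words -size_filter; apply: perm_size.
apply: uniq_perm; rewrite ?filter_uniq ?level_words_uniq// => v.
rewrite mem_filter !mem_level_words; apply/andP/and3P => [[sv /asboolP lv]|[lv sv /asboolP Tv]].
  have Tv := live_part_sub lv; split => //; last exact/asboolP.
  by apply/(markov_live Tv) => // v0; rewrite v0 in sv.
split => //; apply/asboolP/(markov_live Tv) => // v0.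
by rewrite v0 in sv.
Qed.

(** Polynomial growth makes the numbers of occurrences of two letters
    comparable: a letter of maximal degree takes a fixed proportion of every
    late level, one of smaller degree a vanishing proportion. *)
Lemma dead_letter_or_mostly_live :
  (exists i D n0, ~~ live_letter i /\
    forall n, (n0 <= n)%N -> (#|level T n| <= D * letter_count n i)%N) \/
  mostly_live R T.
Proof.
have [|no] := pselect (exists i D n0, ~~ live_letter i /\
    forall n, (n0 <= n)%N -> (#|level T n| <= D * letter_count n i)%N); first by left.
right; have [k tk] := level_poly_growth.
have dead i : ~~ live_letter i -> exists D n0, forall n, (n0 <= n)%N ->
    (n * letter_count n i <= D * #|level T n|)%N.
  move=> di; have [[n0 c0]|[l cl]] := letter_count_has_degree i.
    by exists 0%N, n0 => n nn; rewrite c0// muln0.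
  have [lk|kl] := ltnP l k; first exact: poly_growth_lt lk cl tk.
  case: no; have [C [n0 tC]] := tk; have [C' [n1 cC]] := cl.
  exists i, (C * C')%N, (n0 + n1).+1; split => // n nn.
  have [_ tn] := tC n ltac:(lia); have [cn _] := cC n ltac:(lia).
  rewrite (leq_trans tn)// -mulnA leq_mul// (leq_trans _ cn)// leq_pexp2l//; lia.
have [D [n0 HD]] : exists D n0, forall n, (n0 <= n)%N ->
    (n * \sum_(i | ~~ live_letter i) letter_count n i <= D * #|level T n|)%N.
  have /choice[D /choice[N HN]] : forall i, exists D n0, forall n, (n0 <= n)%N ->
      ~~ live_letter i -> (n * letter_count n i <= D * #|level T n|)%N.
    move=> i; case: (boolP (live_letter i)) => li; first by exists 0%N, 0%N.
    by have [D [n0 H]] := dead i li; exists D, n0 => n nn _; exact: H.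
  exists (\sum_i D i)%N, (\sum_i N i)%N => n nn.
  rewrite big_distrr big_distrl/= [leqRHS](bigID live_letter)/=.
  apply: leq_trans (leq_addl _ _); apply: leq_sum => i li; apply: HN => //.
  by apply: leq_trans nn; rewrite (bigD1 i)//= leq_addr.
move=> e e0; have [n1 Hn1] := nat_unbounded (D%:R / e).
exists (n0 + n1).+1 => n nn; have n_gt0 : (0 < n)%N by lia.
rewrite card_live_level// {1}card_level_letters// (bigID live_letter)/= natrD.
rewrite addrAC subrr add0r.
have := HD n ltac:(lia); rewrite -(ler_nat R) !natrM.
have := Hn1 n ltac:(lia); rewrite ler_pdivrMr//.
move: (\sum_(i | _) _)%N%:R => a nD nt.
have n0' : 0 < n%:R :> R by rewrite ltr0n.
by rewrite -(ler_pM2l n0') (le_trans nt)// mulrA ler_wpM2r.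
Qed.

End MarkovGrowth.

(** * Dense independence sets from positive entropy *)

Section DenseIndependent.
Variables (R : realType) (m d : nat) (X : set (nat -> 'I_m)) (M : 'M[bool]_d).
Local Notation T := (markov_tree M).
Local Notation t n := (#|level T n|%:R : R).
Local Notation l n := (#|level (live_part T) n|%:R : R).
Hypotheses (X_shift : is_shift X) (X_her : hereditary X).
Hypothesis unexpT : unexpandable R T.

(** The tree-shift constrains no label off the rays. *)
Lemma independent_off_rays (B : set 'I_m) (S : set (seq 'I_d)) :
  tree_shift X T !=set0 -> (forall v, S v -> ~ live_part T v) ->
  independent_over B X T S.
Proof.
move=> [x Xx] Sdead u _.
exists (fun v => if `[< S v >] then u v else x v); last first.
  by move=> g Sg; case: asboolP.
move=> r Tr; rewrite (_ : (fun j => _) = fun j => x (mkseq r j)); first exact: Xx.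
apply/funext => j; case: asboolP => // /Sdead; case; exists r => //.
by rewrite size_mkseq.
Qed.

(** When almost all vertices lie on rays, the live vertices whose depth is in
    the support of a point of [X] with positive frequency are independent over
    the letters 0 and 1. They weigh the levels by a nondecreasing sequence of
    polynomial growth, which preserves frequencies. *)
Lemma mostly_live_dense_independent (zero : 'I_m) : val zero = 0%N ->
  mostly_live R T -> (0 < tree_entropy R X T)%E ->
  has_dense_independent_set R [set a : 'I_m | (a <= 1)%N] X T.
Proof.
move=> zero0 liveT hT; have X_inv := X_shift.2.
have X0 : X !=set0.
  have [x Xx] := tree_shift_nonempty hT.
  have [r Tr] := live_ray unexpT liveT.
  by exists (fun j => x (mkseq r j)); exact: Xx.
have [h [_ hE hlow _]] := shift_entropy_bounds R X_inv X0.
have h0 : 0 < h.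
  by rewrite -lte_fin -hE (lt_le_trans hT)// tree_entropy_le.
have [x [delta [Xx d0 freq]]] := nonzero_frequency X_shift X0 h0 (hlow 0%N).
pose S := [set v | live_part T v /\ (0 < x (size v))%N].
have ST : S `<=` T by move=> v [/live_part_sub].
exists S; split => //.
  move=> u uB; exists (fun v => if `[< S v >] then u v else zero); last first.
    by move=> g Sg; case: asboolP.
  move=> r Tr; apply: (X_her Xx) => j; case: asboolP => [Sj|_]; last by rewrite zero0.
  by apply: leq_trans (uB _ Sj) _; case: Sj => _; rewrite size_mkseq.
exists delta => //; apply: density_intro => // e e0.
pose q n : R := (0 < x n)%N%:R.
have qE n : (nonzeros x n)%:R = \sum_(i < n) q i.
  rewrite /nonzeros -sum1_count big_mkcond/= natr_sum -(big_mkord xpredT q).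
  by rewrite /index_iota subn0; apply: eq_bigr => i _; rewrite /q; case: ifP.
have sizeS n : (size (words_below S n))%:R = \sum_(i < n) q i * l i.
  rewrite size_words_below natr_sum; apply: eq_bigr => i _.
  rewrite /q; case: (boolP (0 < x i)%N) => xi.
    rewrite mul1r; congr (_%:R); apply: eq_card => v; rewrite !inE.
    by apply/asboolP/asboolP => [[]//|lv]; split => //; rewrite size_tuple.
  rewrite mul0r; apply/eqP; rewrite pnatr_eq0 cards_eq0; apply/eqP/setP => v.
  rewrite !inE; apply/asboolP => -[_]; rewrite size_tuple; exact/negP.
have [D [n1 HD]] : exists D n1, forall n, (n1 <= n)%N ->
    n%:R * l n <= D%:R * ((size (words_below T n))%:R + 1).
  have [k /poly_growth_cumul[D [n1 HD]]] := level_poly_growth unexpT.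
  exists D, n1 => n /HD; rewrite natr1 -size_words_below -!natrM ler_nat.
  apply: leq_trans; rewrite leq_mul//; apply: subset_leq_card.
  by apply/fintype.subsetP => v; rewrite !inE; exact: live_part_sub.
(* the error of the summation by parts is at most 4 e1 D times the size of the
   ball, once n is so large that C <= e1 n *)
pose e1 := e / (8 * (D%:R + 1)).
have D1 : 0 < D%:R + 1 :> R by rewrite ltr_wpDl.
have e1_gt0 : 0 < e1 by rewrite divr_gt0// mulr_gt0.
have [C HC] := freq e1 e1_gt0; have [n2 Hn2] := nat_unbounded (C / e1).
have lS n : l n <= l n.+1 by rewrite ler_nat live_level_nondecreasing.
have freq_q n : `|\sum_(i < n) q i - delta * n%:R| <= e1 * n%:R + C.
  by rewrite -qE; exact: HC.
have abel := abel_frequency (fun n => ler0n _ _) lS (ltW e1_gt0) freq_q.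
have e2_gt0 : 0 < e / (2 * delta) by rewrite divr_gt0// mulr_gt0.
have [|C2 HC2] := @weighted_cesaro R (fun n => l n) (fun n => t n) 1
    (fun=> ler0n _ _) _ _ e2_gt0.
  move=> c /liveT[n3 H3]; exists n3 => n /H3; rewrite mul1r distrC.
  rewrite ger0_norm// subr_ge0 ler_nat; apply: subset_leq_card.
  by apply/fintype.subsetP => v; rewrite !inE; exact: live_part_sub.
exists (e / 2 + delta * C2), (n1 + n2)%N => n nn; rewrite sizeS.
have := abel n; have := HC2 n; have := HD n ltac:(lia).
have := Hn2 n ltac:(lia); rewrite ler_pdivrMr//.
have bE : \sum_(i < n) t i = (size (words_below T n))%:R.
  by rewrite size_words_below natr_sum.
rewrite bE mul1r; have := ler0n R (size (words_below T n)).
move: (size _)%:R (\sum_(i < n) l i) (\sum_(i < n) q i * l i) {bE} =>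
  b sl sq b0 Cn nl hl hq.
have ln0 : 0 <= l n by [].
have hq' : `|sq - delta * sl| <= e / 2 * (b + 1).
  apply: (le_trans hq).
  have : (e1 * n%:R + C) * l n *+ 2 <= 4 * e1 * (n%:R * l n).
    have := ler_wpM2r ln0 Cn; rewrite mulr2n; lra.
  move/le_trans; apply.
  have e14 : 0 <= 4 * e1 by rewrite mulr_ge0// ltW.
  apply: (le_trans (ler_wpM2l e14 nl)).
  have b1 : 0 <= b + 1 by rewrite addr_ge0.
  rewrite mulrA ler_wpM2r// /e1.
  have -> : 4 * (e / (8 * (D%:R + 1))) * D%:R = e / 2 * (D%:R / (D%:R + 1)).
    by field; rewrite gt_eqF.
  by rewrite ler_piMr ?divr_ge0 ?(ltW e0)// ler_pdivrMr// mul1r lerDl.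
have hl' : `|delta * (sl - b)| <= e / 2 * b + delta * C2.
  rewrite normrM (gtr0_norm d0); apply: (le_trans (ler_wpM2l (ltW d0) hl)).
  rewrite mulrDr lerD2r (_ : delta * _ = e / 2 * b)//.
  by field; rewrite gt_eqF.
have -> : sq - delta * b = (sq - delta * sl) + delta * (sl - b) by ring.
by apply: (le_trans (ler_normD _ _)); lra.
Qed.

(** When the leaves are not negligible the independence set is found among the
    vertices that end in a fixed letter from which no ray starts. *)
Lemma entropy_dense_independent (zero : 'I_m) : val zero = 0%N ->
  (0 < tree_entropy R X T)%E ->
  has_dense_independent_set R [set a : 'I_m | (a <= 1)%N] X T.
Proof.
move=> zero0 hT; have [[i [D [n0 [di HD]]]]|liveT] := dead_letter_or_mostly_live unexpT.
  2: exact: mostly_live_dense_independent zero0 liveT hT.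
pose S := [set v | T v /\ last_in (pred1 i) v].
have ST : S `<=` T by move=> v [].
have [|S' S'S [delta d0 dS']] := @dense_subset R _ T unexpT S D n0 ST.
  move=> n /HD; rewrite /letter_count -size_filter -[#|level S n|]size_level_words.
  rewrite (_ : size [seq v <- level_words T n | last_in (pred1 i) v] =
    size (level_words S n))//.
  apply: perm_size; apply: uniq_perm; rewrite ?filter_uniq ?level_words_uniq// => v.
  rewrite mem_filter !mem_level_words andbCA; congr andb.
  by apply/andP/asboolP => [[vi /asboolP]|[Tv vi]]//; split => //; apply/asboolP.
exists S'; split; first exact: subset_trans ST.
  apply: independent_off_rays; first exact: tree_shift_nonempty hT.
  move=> v /S'S[Tv vi] lv; case/negP: di.
  have vn : v <> [::] by move=> v0; rewrite v0 in vi.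
  by move/(markov_live Tv vn): lv; case: v vi {Tv vn} => //= y s /eqP ->.
by exists delta.
Qed.

End DenseIndependent.

Theorem theorem1p3 (R : realType) :
  (forall (m : nat) (X : set (nat -> 'I_m)) (d : nat) (M : 'M[bool]_d),
      (2 <= m)%N -> is_shift X -> hereditary X ->
      unexpandable R (markov_tree M) ->
      [/\ leafless (markov_tree M) ->
            tree_entropy R X (markov_tree M) = shift_entropy R X,
          (0 < tree_entropy R X (markov_tree M))%E <->
            has_dense_independent_set R [set a : 'I_m | (a <= 1)%N] X
              (markov_tree M),
          has_dense_independent_set R [set: 'I_m] X (markov_tree M) ->
            (0 < tree_entropy R X (markov_tree M))%E
        & m = 2%N ->
            ((0 < tree_entropy R X (markov_tree M))%E <->
             has_dense_independent_set R [set: 'I_m] X (markov_tree M))]) /\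
  (forall (A : finType) (X : set (nat -> A)) (d : nat) (T : set (seq 'I_d)),
      (2 <= #|A|)%N -> is_shift X -> shift_entropy R X = 0%E ->
      is_tree T -> leafless T -> unexpandable R T ->
      ~ has_dense_independent_set R [set: A] X T).
Proof.
split=> [m X d M m2 X_shift X_her unexpT|A X d T A2 X_shift hX treeT leaflessT unexpT].
  pose T := markov_tree M; pose zero := Ordinal (ltnW m2); pose one := Ordinal m2.
  have zero0 : val zero = 0%N by [].
  have zero_one : zero <> one by [].
  have gt0_dense : (0 < tree_entropy R X T)%E <->
      has_dense_independent_set R [set a : 'I_m | (a <= 1)%N] X T.
    split; first exact: entropy_dense_independent zero0.
    exact: (dense_independent_entropy zero_one).
  have full_gt0 : has_dense_independent_set R [set: 'I_m] X T ->
      (0 < tree_entropy R X T)%E.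
    exact: (dense_independent_entropy zero_one).
  split => // [leaflessT|mE].
    apply/eqP; rewrite eq_le; apply/andP; split.
      apply: (tree_entropy_le unexpT _ X_shift.2).
      exact: leafless_mostly_live (markov_is_tree M) leaflessT.
    exact: (tree_entropy_ge unexpT leaflessT X_shift.2 X_her zero0).
  rewrite (_ : setT = [set a : 'I_m | (a <= 1)%N])//.
  by apply/seteqP; split => // a _ /=; have := ltn_ord a; lia.
move=> dense; have [a [b ab]] : exists a b : A, a <> b.
  have [a] : exists a : A, a \in A by apply/card_gt0P; exact: ltnW.
  move=> _; have [b] : exists b, b \in predC1 a.
    by apply/card_gt0P; rewrite cardC1; case: #|A| A2 => [|[]].
  by rewrite inE => /eqP ba; exists a, b => ab; apply: ba.
have := dense_independent_entropy ab (I : [set: A] a) (I : [set: A] b) dense.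
rewrite lt_neqAle => /andP[/eqP ne0 ge0]; apply: ne0; apply/eqP.
rewrite eq_le ge0 -hX tree_entropy_le//; first exact: leafless_mostly_live.
exact: X_shift.2.
Qed.
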